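(* Let $0\le\beta<1$. The mapping $$C:\big((E)_\beta^*,+,\cdot,\diamond\big)\to\big(L((E)_\beta,(E)_\beta),+,\cdot,\circ\big),\qquad\varphi\mapsto C_\varphi,$$ is an injective continuous algebra homomorphism. In particular, $C$ is a topological isomorphism from $(E)_\beta^*$ onto $\mathrm{Im}(C)$.
   Context: White noise spaces. Let $H=L^2(\mathbb{R},dt)$ (real-valued) with norm $|\cdot|_0$, and let $A$ be a positive self-adjoint operator on $H$ with $\inf\sigma(A)>1$ and Hilbert-Schmidt inverse. Put $|\xi|_p=|A^p\xi|_0$, and let $E=\{\xi\in H:|\xi|_p<\infty\ \forall p\}$, a nuclear Fréchet space dense in $H$; $E^*$ is its strong dual, $E_{\mathbb{C}}$ the complexification. $\langle\cdot,\cdot\rangle$ denotes the canonical $\mathbb{C}$-bilinear pairings; $|\cdot|_p$ also denotes the corresponding norms on tensor powers; the subscript ''sym'' denotes symmetric elements. $:x^{\otimes n}:$ is the Wick ordering of $x^{\otimes n}$ with respect to the standard Gaussian measure $\mu$ on $E^*$. For $0\le\beta<1$, $(E)_\beta$ is the space of $\varphi=\sum_{n\ge0}\langle:x^{\otimes n}:,f_n\rangle$, $f_n\in(E_{\mathbb{C}}^{\otimes n})_{sym}$ (written $\varphi\sim(f_n)$), with $|\varphi|_{p,\beta}^2=\sum_n(n!)^{1+\beta}|f_n|_p^2<\infty$ for all $p$; with these norms it is a nuclear Fréchet space. $(E)_\beta^*$ is its strong dual; each $\Psi\in(E)_\beta^*$ corresponds to a unique sequence $\Psi\sim(F_n)$,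 $F_n\in(E_{\mathbb{C}}^{\otimes n})^*_{sym}$, via $\langle\langle\Psi,\varphi\rangle\rangle=\sum_n n!\langle F_n,f_n\rangle$, with $\sum_n(n!)^{1-\beta}|F_n|_{-p}^2<\infty$ for some $p$. For $\xi\in E_{\mathbb{C}}$, $\Phi_\xi\sim(\xi^{\otimes n}/n!)_n\in(E)_\beta$; the $S$-transform is $S(\Psi)(\xi)=\langle\langle\Psi,\Phi_\xi\rangle\rangle$; the Wick product of $\Psi,\Theta\in(E)_\beta^*$ is $\Psi\diamond\Theta=S^{-1}(S(\Psi)\cdot S(\Theta))\in(E)_\beta^*$. For $\varphi\in(E)_\beta^*$, $\widetilde{M_\varphi}\in L((E)_\beta^*,(E)_\beta^* )$ is $\widetilde{M_\varphi}(\psi)=\varphi\diamond\psi$. The convolution operator $C_\varphi$ is the dual operator of $\widetilde{M_\varphi}$, acting on $(E)_\beta$ (by reflexivity): $\langle\langle\psi,C_\varphi\phi\rangle\rangle=\langle\langle\varphi\diamond\psi,\phi\rangle\rangle$ for $\psi\in(E)_\beta^*$, $\phi\in(E)_\beta$. $L(X,X)$ is the space of continuous linear operators with the topology of bounded convergence (seminorms $\sup_{\xi\in M}|T\xi|_p$, $M\subset X$ bounded); $\mathrm{Im}(C)$ carries the subspace topology. *)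

(* Defs.v *)
From HB Require Import structures.
From mathcomp Require Import all_boot all_order all_algebra.
From mathcomp Require Import all_classical all_reals all_analysis.
From mathcomp Require Import complex ring lra.

Set Implicit Arguments.
Unset Strict Implicit.
Unset Printing Implicit Defensive.

Import Order.TTheory GRing.Theory Num.Theory.
Import numFieldNormedType.Exports Normc.

Local Open Scope classical_set_scope.
Local Open Scope ring_scope.
Local Open Scope quotient_scope.

Lemma le1_2 (R : realType) : (1 <= 2%:E :> \bar R)%E.
Proof. by rewrite lee_fin ler1n. Qed.

Section L2.
Variable R : realType.
Local Notation mu := (@lebesgue_measure R : {measure set _ -> \bar R}).
Local Notation sqint := (LfunType mu (le1_2 R)).

Definition ae0 : {pred sqint} :=
  [pred f : sqint | `[< {ae mu, forall x, (f : R -> R) x = 0} >]].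

Lemma ae0P (f : sqint) :
  reflect {ae mu, forall x, (f : R -> R) x = 0} (f \in ae0).
Proof. exact: asboolP. Qed.

Lemma ae0_zmod_closed : zmod_closed ae0.
Proof.
split; first by apply/ae0P; apply: aeW.
move=> f g /ae0P f0 /ae0P g0; apply/ae0P.
apply: (@filterS2 _ _ (ae_filter_ringOfSetsType mu) _ _ _ _ f0 g0) => x fx gx.
by rewrite -[LHS]/((f : R -> R) x - (g : R -> R) x) fx gx subrr.
Qed.

HB.instance Definition _ := GRing.isZmodClosed.Build sqint ae0 ae0_zmod_closed.

(* L2 R is the real Hilbert space L^2(R, dt): square-integrable functions modulo
   almost everywhere equality, as a quotient of the library's LfunType. *)
Definition L2 := Quotient.quot ae0.
HB.instance Definition _ := GRing.Zmodule.on L2.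
HB.instance Definition _ := EqQuotient.on L2.

Lemma ae0Z a (f : sqint) : f \in ae0 -> a *: f \in ae0.
Proof.
move=> /ae0P f0; apply/ae0P; apply: (@filterS _ _ (ae_filter_ringOfSetsType mu) _ _ _ f0) => x fx.
by rewrite -[LHS]/(a * (f : R -> R) x) fx mulr0.
Qed.

Definition l2scale (a : R) (x : L2) : L2 := \pi_L2 (a *: (repr x : sqint)).

Lemma l2scale_pi a (f : sqint) : l2scale a (\pi_L2 f) = \pi_L2 (a *: f).
Proof.
apply/eqP; rewrite /l2scale -Quotient.idealrBE -scalerBr; apply: ae0Z.
by rewrite Quotient.idealrBE reprK.
Qed.

Lemma l2_pi (x : L2) : exists f : sqint, x = \pi_L2 f.
Proof. by exists (repr x); rewrite reprK. Qed.

Lemma l2_piD (f g : sqint) : \pi_L2 (f + g) = \pi_L2 f + \pi_L2 g.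
Proof. exact: Quotient.pi_add. Qed.

Lemma l2scaleA a b (x : L2) : l2scale a (l2scale b x) = l2scale (a * b) x.
Proof. by have [f ->] := l2_pi x; rewrite !l2scale_pi scalerA. Qed.

Lemma l2scale1 : left_id 1 l2scale.
Proof. by move=> x; have [f ->] := l2_pi x; rewrite l2scale_pi scale1r. Qed.

Lemma l2scaleDr : right_distributive l2scale +%R.
Proof.
move=> a x y; have [f ->] := l2_pi x; have [g ->] := l2_pi y.
by rewrite -l2_piD !l2scale_pi scalerDr l2_piD.
Qed.

Lemma l2scaleDl (x : L2) : {morph l2scale^~ x : a b / a + b}.
Proof.
move=> a b; have [f ->] := l2_pi x.
by rewrite !l2scale_pi scalerDl l2_piD.
Qed.

HB.instance Definition _ := GRing.Zmodule_isLmodule.Build R L2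
  l2scaleA l2scale1 l2scaleDr l2scaleDl.

(* The integral does not depend on the representatives. *)
Definition l2dot (x y : L2) : R :=
  (\int[mu]_t ((repr x : R -> R) t * (repr y : R -> R) t))%R.

End L2.

Section Operators.
Variables (R : realType) (V : lmodType R) (dot : V -> V -> R).

(* op is only meaningful on dom. *)
Record unbounded := Unbounded { dom : set V ; op :> V -> V }.

Definition linear_op (A : unbounded) := dom A 0 /\
  forall (a : R) x y, dom A x -> dom A y ->
    dom A (a *: x + y) /\ A (a *: x + y) = a *: A x + A y.

Definition norm0 (x : V) : R := Num.sqrt (dot x x).

Definition densely_defined (A : unbounded) :=
  forall x (e : R), 0 < e -> exists2 y, dom A y & norm0 (x - y) < e.

(* A^* = A as graphs: the left-hand side says that (y, z) is in the graph of A^*. *)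
Definition self_adjoint (A : unbounded) := forall y z,
  (forall x, dom A x -> dot (A x) y = dot x z) <-> (dom A y /\ A y = z).

Definition positive_op (A : unbounded) :=
  forall x, dom A x -> 0 <= dot (A x) x.

Definition inverse_op (A : unbounded) (B : V -> V) :=
  (forall x, dom A (B x) /\ A (B x) = x) /\ (forall x, dom A x -> B (A x) = x).

Definition bounded_op (B : V -> V) :=
  exists K : R, forall x, norm0 (B x) <= K * norm0 x.

Definition shift (A : unbounded) (l : R) :=
  Unbounded (dom A) (fun x => A x - l *: x).

Definition resolvent_set (A : unbounded) : set R :=
  [set l | exists2 B, inverse_op (shift A l) B & bounded_op B].

(* Only real spectral values are considered: the spectrum (on the
   complexification) of a self-adjoint operator is real. *)
Definition spectrum (A : unbounded) : set R := ~` resolvent_set A.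

Definition orthonormal (I : eqType) (h : I -> V) :=
  forall i j, dot (h i) (h j) = (i == j)%:R.

Definition orthonormal_basis (e : nat -> V) :=
  orthonormal e /\ forall x, (forall n, dot x (e n) = 0) -> x = 0.

Definition hilbert_schmidt (B : V -> V) :=
  exists2 e : nat -> V, orthonormal_basis e &
    (\sum_(0 <= n <oo) (norm0 (B (e n)) ^+ 2)%:E < +oo)%E.

Definition white_noise_op (A : unbounded) :=
  [/\ linear_op A, densely_defined A, self_adjoint A, positive_op A &
      (1 < ereal_inf (EFin @` spectrum A))%E] /\
  exists2 B, inverse_op A B & hilbert_schmidt B.

(* The domain of A^p; on it, A^p is iter p A. *)
Fixpoint dom_pow (A : unbounded) (p : nat) : set V :=
  if p is q.+1 then [set x | dom A x /\ dom_pow A q (A x)] else setT.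

(* |x|_p = norm0 (iter p A x) is finite exactly when x is in the domain of A^p. *)
Definition testE (A : unbounded) : set V := [set x | forall p, dom_pow A p x].

End Operators.

Section TestSpace.
Variables (R : realType) (V : lmodType R) (dot : V -> V -> R).
Variables (A : unbounded V) (beta : R).
Local Notation C := (R[i]^o).

(* A sequence (f_n) of tensors is encoded by one function f on lists of vectors:
   f_n is the restriction of f to lists of length n.  The Hilbert tensor power
   (V_C)^{(x) n} is realized as the space of Hilbert-Schmidt n-linear forms
   V^n -> C, where h_1 (x) ... (x) h_n is
   (g_1, ..., g_n) |-> <h_1, g_1> ... <h_n, g_n>. *)
Definition multilinear (f : seq V -> C) := forall s t (a : R) x y,
  f (s ++ (a *: x + y) :: t) = a%:C%C * f (s ++ x :: t) + f (s ++ y :: t).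

Definition symmetric_form (f : seq V -> C) :=
  forall s t, perm_eq s t -> f s = f t.

(* |f_n|_p^2, i.e. the squared Hilbert-Schmidt norm of (A^{(x) n})^p f_n, which is
   the form (g_1, ..., g_n) |-> f_n (A^p g_1, ..., A^p g_n).  As dom A^p is dense,
   this norm is the supremum over finite orthonormal families in dom A^p.
   Finiteness for p = 0 is the Hilbert-Schmidt property of f_n, and
   (E_C)^{(x) n} is the set of f_n such that all |f_n|_p are finite. *)
Definition tnorm2 (p n : nat) (f : seq V -> C) : \bar R :=
  ereal_sup [set x | exists k (h : 'I_k -> V),
    [/\ forall i, dom_pow A p (h i), orthonormal dot h &
        x = (\sum_(j : n.-tuple 'I_k)
               (normc (f [seq iter p A (h i) | i <- j]) : R) ^+ 2)%:E]].

Definition chaos_norm2 (p : nat) (f : seq V -> C) : \bar R :=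
  (\sum_(0 <= n <oo) (n`!%:R `^ (1 + beta))%:E * tnorm2 p n f)%E.

Definition is_test : {pred seq V -> C} := [pred f |
  `[< [/\ multilinear f, symmetric_form f &
          forall p, (chaos_norm2 p f < +oo)%E] >]].

Lemma tnorm2_ge0 p n f : (0 <= tnorm2 p n f)%E.
Proof.
apply: le_trans (ereal_sup_ubound _); last first.
  exists 0%N, (fun=> 0); split; [by case|by case|reflexivity].
by rewrite lee_fin sumr_ge0// => j _; rewrite sqr_ge0.
Qed.

Lemma sqnormcD (x y : R[i]) : (normc (x + y) : R) ^+ 2 <=
  2 * (normc x ^+ 2 + normc y ^+ 2).
Proof.
have nx : 0 <= (normc x : R) by case: x => a b; exact: sqrtr_ge0.
have ny : 0 <= (normc y : R) by case: y => a b; exact: sqrtr_ge0.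
have nxy : 0 <= (normc (x + y) : R).
  by case: (x + y) => a b; exact: sqrtr_ge0.
have := le_normcD x y.
move: (normc (x + y)) (normc x) (normc y) nx ny nxy => c a b.
move=> a0 b0 c0 cab; apply: (@le_trans _ _ ((a + b) ^+ 2)).
  by rewrite lerXn2r ?nnegrE ?addr_ge0.
rewrite -subr_ge0 (_ : _ - _ = (a - b) ^+ 2) ?sqr_ge0//.
ring.
Qed.

Lemma tnorm2D p n f g :
  (tnorm2 p n (f + g)%R <= 2%:E * (tnorm2 p n f + tnorm2 p n g))%E.
Proof.
apply: ub_ereal_sup => _ [k [h [hA oh ->]]].
apply: (@le_trans _ _ (2%:E *
  ((\sum_(j : n.-tuple 'I_k) (normc (f [seq iter p A (h i) | i <- j])) ^+ 2)%:E
  + (\sum_(j : n.-tuple 'I_k) (normc (g [seq iter p A (h i) | i <- j])) ^+ 2)%:E))%E).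
  rewrite -EFinD -EFinM lee_fin -big_split/= mulr_sumr ler_sum// => j _.
  exact: sqnormcD.
by apply: lee_wpmul2l => //; apply: leeD; apply: ereal_sup_ubound; exists k, h.
Qed.

Lemma tnorm2Z p n (a : R[i]) f :
  (tnorm2 p n (a *: f)%R <= (normc a ^+ 2)%:E * tnorm2 p n f)%E.
Proof.
apply: ub_ereal_sup => _ [k [h [hA oh ->]]].
apply: (@le_trans _ _ ((normc a ^+ 2)%:E *
  (\sum_(j : n.-tuple 'I_k) (normc (f [seq iter p A (h i) | i <- j])) ^+ 2)%:E)%E).
  rewrite -EFinM lee_fin mulr_sumr ler_sum// => j _.
  by rewrite -exprMn -normcM.
apply: lee_wpmul2l; first by rewrite lee_fin sqr_ge0.
by apply: ereal_sup_ubound; exists k, h.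
Qed.

Let wt n : (0 <= (n`!%:R `^ (1 + beta) : R)%:E)%E.
Proof. by rewrite lee_fin powR_ge0. Qed.

Let chaos_term_ge0 p f n :
  (0 <= (n`!%:R `^ (1 + beta))%:E * tnorm2 p n f)%E.
Proof. by rewrite mule_ge0// tnorm2_ge0. Qed.

Lemma chaos_norm2_ge0 p f : (0 <= chaos_norm2 p f)%E.
Proof. by apply: nneseries_ge0 => n _ _; exact: chaos_term_ge0. Qed.

Lemma chaos_norm2D p f g : (chaos_norm2 p (f + g)%R <=
  2%:E * (chaos_norm2 p f + chaos_norm2 p g))%E.
Proof.
rewrite -(nneseriesD (fun n _ _ => chaos_term_ge0 p f n)
  (fun n _ _ => chaos_term_ge0 p g n)).
rewrite -(nneseriesZl 2 0 (fun n _ =>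
  adde_ge0 (chaos_term_ge0 p f n) (chaos_term_ge0 p g n))).
apply: lee_nneseries => [n _ _|n _]; first exact: chaos_term_ge0.
rewrite -muleDr ?ge0_adde_def ?inE ?tnorm2_ge0// muleCA.
by apply: lee_wpmul2l => //; exact: tnorm2D.
Qed.

Lemma chaos_norm2Z p (a : R[i]) f :
  (chaos_norm2 p (a *: f)%R <= (normc a ^+ 2)%:E * chaos_norm2 p f)%E.
Proof.
rewrite -(nneseriesZl (normc a ^+ 2) 0 (fun n _ => chaos_term_ge0 p f n)).
apply: lee_nneseries => [n _ _|n _]; first exact: chaos_term_ge0.
by rewrite muleCA; apply: lee_wpmul2l => //; exact: tnorm2Z.
Qed.

Lemma chaos_norm2_0 p : chaos_norm2 p 0 = 0%E.
Proof.
apply/eqP; rewrite eq_le chaos_norm2_ge0 andbT.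
have := chaos_norm2Z p 0 0; rewrite scale0r => /le_trans; apply.
by rewrite [normc 0]normc0 expr0n/= mul0e.
Qed.

Lemma is_test_submod : submod_closed is_test.
Proof.
split.
  apply/asboolP; split.
  - by move=> s t a x y; rewrite [RHS]addr0 mulr0.
  - by [].
  - by move=> p; rewrite chaos_norm2_0.
move=> a f g /asboolP[fm fs fn] /asboolP[gm gs gn]; apply/asboolP; split.
- move=> s t b x y; have := fm s t b x y; have := gm s t b x y.
  rewrite !fctE /= => -> ->; rewrite /GRing.scale/=; ring.
- by move=> s t st; rewrite !fctE /= (fs _ _ st) (gs _ _ st).
- move=> p; apply: le_lt_trans (chaos_norm2D _ _ _) _.
  rewrite lte_mul_pinfty// lte_add_pinfty//.
  apply: le_lt_trans (chaos_norm2Z _ _ _) _.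
  by rewrite lte_mul_pinfty// lee_fin sqr_ge0.
Qed.

HB.instance Definition _ :=
  GRing.isSubmodClosed.Build R[i] (seq V -> C) is_test is_test_submod.

(* The space (E)_beta; an element phi = sum_n <:x^{(x) n}:, f_n> is represented by
   its uniquely determined sequence of kernels (f_n). *)
Record test := Test { chaos :> seq V -> C ; testP : chaos \in is_test }.

HB.instance Definition _ := [isSub for chaos].
HB.instance Definition _ := [Choice of test by <:].
HB.instance Definition _ := [SubChoice_isSubLmodule of test by <:].

Definition test_norm (p : nat) (f : test) : R :=
  Num.sqrt (fine (chaos_norm2 p f)).

End TestSpace.

Section TestTopology.
Variables (R : realType) (V : lmodType R) (dot : V -> V -> R).
Variables (A : unbounded V) (beta : R).
Local Notation C := (R[i]^o).
Local Notation X := (test dot A beta).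
Local Notation N := (@test_norm R V dot A beta).

Lemma chaos_normK p (f : X) :
  chaos_norm2 dot A beta p f = (N p f ^+ 2)%:E.
Proof.
have f0 := chaos_norm2_ge0 dot A beta p f.
have /asboolP[_ _ foo] := testP f.
rewrite sqr_sqrtr ?fine_ge0// fineK//.
by rewrite ge0_fin_numE.
Qed.

Lemma test_norm_ge0 p (f : X) : 0 <= N p f.
Proof. exact: sqrtr_ge0. Qed.

Lemma test_normD p (f g : X) : N p (f + g) <= 2 * (N p f + N p g).
Proof.
have f0 := test_norm_ge0 p f; have g0 := test_norm_ge0 p g.
have := chaos_norm2D dot A beta p f g.
rewrite -[((f : seq V -> C) + (g : seq V -> C))]/((f + g : X) : seq V -> C).
rewrite !chaos_normK -EFinD -EFinM lee_fin => h.
rewrite -(@ler_pXn2r _ 2)// ?nnegrE ?test_norm_ge0// ?mulr_ge0 ?addr_ge0//.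
by apply: le_trans h _; nra.
Qed.

Lemma test_normZ p (a : R[i]) (f : X) : N p (a *: f) <= normc a * N p f.
Proof.
have f0 := test_norm_ge0 p f.
have a0 : 0 <= (normc a : R) by case: a => x y; exact: sqrtr_ge0.
have := chaos_norm2Z dot A beta p a f.
rewrite -[(a *: (f : seq V -> C))]/((a *: f : X) : seq V -> C).
rewrite !chaos_normK -EFinM lee_fin => h.
rewrite -(@ler_pXn2r _ 2)// ?nnegrE ?test_norm_ge0// ?mulr_ge0//.
by rewrite exprMn.
Qed.

Lemma test_normN p (f : X) : N p (- f) <= N p f.
Proof.
rewrite -scaleN1r; apply: le_trans (test_normZ _ _ _) _.
by rewrite [normc _](normcN (1 : R[i])) [normc _]normc1 mul1r.
Qed.

Lemma test_norm0 p : N p 0 = 0.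
Proof. by rewrite /test_norm [chaos_norm2 _ _ _ _ _]chaos_norm2_0 sqrtr0. Qed.

(* The locally convex topology of (E)_beta is the one given by the norms |.|_{p,beta}. *)
Definition test_strip (ne : nat * R) : set (X * X) :=
  [set fg | forall p, (p <= ne.1)%N -> N p (fg.1 - fg.2) < ne.2].

Definition test_ent : set_system (X * X) :=
  filter_from [set ne : nat * R | 0 < ne.2] test_strip.

Lemma test_ent_filter : Filter test_ent.
Proof.
apply: filter_from_filter; first by exists (0%N, 1) => /=.
move=> [n e] [m d] /= e0 d0; exists (maxn n m, Num.min e d) => /=.
  by rewrite lt_min e0.
move=> fg /= h; split=> p pn /=.
  by have := h p (leq_trans pn (leq_maxl _ _)); rewrite lt_min => /andP[].
by have := h p (leq_trans pn (leq_maxr _ _)); rewrite lt_min => /andP[].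
Qed.

Local Open Scope relation_scope.

Lemma test_ent_diagonal E : test_ent E -> diagonal `<=` E.
Proof.
move=> [[n e]/= e0 nE] [f g] /diagonalP ->; apply: nE => p _ /=.
by rewrite subrr test_norm0.
Qed.

Lemma test_ent_inv E : test_ent E -> test_ent E^-1.
Proof.
move=> [[n e]/= e0 nE]; exists (n, e) => //= -[f g] /= h; apply: nE => p pn /=.
by rewrite -opprB; apply: le_lt_trans (test_normN _ _) _; exact: h.
Qed.

Lemma test_ent_split E : test_ent E ->
  exists2 F, test_ent F & F \; F `<=` E.
Proof.
move=> [[n e]/= e0 nE]; exists (test_strip (n, e / 4)).
  by exists (n, e / 4) => //=; rewrite divr_gt0.
move=> [f h] /= [g fg gh]; apply: nE => p pn /=.
have := fg p pn; have := gh p pn => /= b1 b2.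
rewrite -(subrK g f) -addrA; apply: le_lt_trans (test_normD _ _ _) _.
lra.
Qed.

Local Close Scope relation_scope.

HB.instance Definition _ := isUniform.Build X
  test_ent_filter test_ent_diagonal test_ent_inv test_ent_split.

Lemma cvg_testP (T : Type) (F : set_system T) {FF : Filter F} (u : T -> X) f :
  u @ F --> f <-> forall p e, 0 < e -> \forall t \near F, N p (f - u t) < e.
Proof.
split=> [/cvg_app_entourageP uf p e e0|h].
  have /uf : entourage (test_strip (p, e)) by exists (p, e).
  by apply: filterS => t /= /(_ p); apply.
apply/cvg_app_entourageP => E [[n e] /= e0 nE].
have : \forall t \near F, forall p : 'I_n.+1, N p (f - u t) < e.
  by apply: filter_forall => p; exact: h.
by apply: filterS => t ht; apply: nE => p pn /=; exact: (ht (Ordinal (pn : p < n.+1)%N)).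
Qed.

Definition is_dual : {pred X -> C} := [pred Psi : X -> C |
  `[< (forall a f g, Psi (a *: f + g) = a *: Psi f + Psi g) /\
      continuous Psi >]].

Lemma is_dual_submod : submod_closed is_dual.
Proof.
split.
  apply/asboolP; split; first by move=> a f g; rewrite /= scaler0 addr0.
  exact: (@cst_continuous X C 0).
move=> a Psi Theta /asboolP[Pl Pc] /asboolP[Tl Tc]; apply/asboolP; split.
  by move=> b f g; rewrite !fctE /= Pl Tl /GRing.scale/=; ring.
move=> f; exact: (@cvgD _ C X (nbhs f) (nbhs_filter f) (fun g => a *: Psi g) Theta
  _ _ (@cvgZl_tmp R[i] C X (nbhs f) (nbhs_filter f) a Psi _ (Pc f)) (Tc f)).
Qed.

HB.instance Definition _ :=
  GRing.isSubmodClosed.Build R[i] (X -> C) is_dual is_dual_submod.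

(* (E)_beta^* *)
Record dual := Dual { dual_fun :> X -> C ; dualP : dual_fun \in is_dual }.

HB.instance Definition _ := [isSub for dual_fun].
HB.instance Definition _ := [Choice of dual by <:].
HB.instance Definition _ := [SubChoice_isSubLmodule of dual by <:].

Lemma test_continuousP (u : X -> X) : continuous u <-> forall f p e, 0 < e ->
  \forall g \near f, N p (u f - u g) < e.
Proof.
split=> [cu f|h f]; first by apply/(@cvg_testP _ _ (nbhs_filter f) u); exact: cu.
by apply/(@cvg_testP _ _ (nbhs_filter f) u); exact: h.
Qed.

Lemma test_continuousZD (a : R[i]) (S T : X -> X) : continuous S ->
  continuous T -> continuous (fun f => a *: S f + T f).
Proof.
move=> /test_continuousP Sc /test_continuousP Tc.
apply/test_continuousP => f p e e0.
have c0 : 0 <= (normc a : R) by case: a => x y; exact: sqrtr_ge0.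
have k0 : 0 < 4 * (normc a + 1) :> R by lra.
have := Sc f p (e / (4 * (normc a + 1))).
rewrite divr_gt0// => /(_ isT) S1.
have := Tc f p (e / 4); rewrite divr_gt0// => /(_ isT) T1.
apply: (@filterS2 _ _ (nbhs_filter f) _ _ _ _ S1 T1) => g {}S1 {}T1.
rewrite opprD addrACA -scalerBr.
apply: le_lt_trans (test_normD _ _ _) _.
have := test_normZ p a (S f - S g).
move: S1; rewrite ltr_pdivlMr// => S1; have := test_norm_ge0 p (S f - S g).
nra.
Qed.

Definition is_lop : {pred X -> X} := [pred T : X -> X |
  `[< (forall a f g, T (a *: f + g) = a *: T f + T g) /\ continuous T >]].

Lemma is_lop_submod : submod_closed is_lop.
Proof.
split.
  apply/asboolP; split; first by move=> a f g; rewrite /= scaler0 addr0.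
  exact: (@cst_continuous X X 0).
move=> a S T /asboolP[Sl Sc] /asboolP[Tl Tc]; apply/asboolP; split.
  move=> b f g; rewrite !fctE /= Sl Tl !scalerDr !scalerA (mulrC a b).
  by rewrite addrACA.
exact: test_continuousZD.
Qed.

HB.instance Definition _ :=
  GRing.isSubmodClosed.Build R[i] (X -> X) is_lop is_lop_submod.

(* L((E)_beta, (E)_beta) *)
Record lop := Lop { lop_fun :> X -> X ; lopP : lop_fun \in is_lop }.

HB.instance Definition _ := [isSub for lop_fun].
HB.instance Definition _ := [Choice of lop by <:].
HB.instance Definition _ := [SubChoice_isSubLmodule of lop by <:].

Lemma lop_compP (S T : lop) : (S : X -> X) \o T \in is_lop.
Proof.
have /asboolP[Sl Sc] := lopP S; have /asboolP[Tl Tc] := lopP T.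
apply/asboolP; split; first by move=> a f g; rewrite /= Tl Sl.
by move=> f; apply: continuous_comp; [exact: Tc|exact: Sc].
Qed.

Definition lop_comp (S T : lop) : lop := Lop (lop_compP S T).

Definition test_bounded (M : set X) :=
  forall p, exists K : R, forall f, M f -> N p f <= K.

(* The strong dual topology. *)
HB.instance Definition _ := Uniform.copy dual
  (initial_topology (dual_fun : dual -> {family test_bounded, X -> C})).

(* The topology of bounded convergence. *)
HB.instance Definition _ := Uniform.copy lop
  (initial_topology (lop_fun : lop -> {family test_bounded, X -> X})).

(* A pair (x, y) stands for x + i y in the complexification E_C. *)
Definition testEC : set (V * V) :=
  [set xi | testE A xi.1 /\ testE A xi.2].

(* (xi^{(x) n} / n!)_n *)
Definition exp_chaos (xi : V * V) : seq V -> C := fun s =>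
  (size s)`!%:R^-1 * \prod_(g <- s) (dot xi.1 g +i* dot xi.2 g)%C.

(* For xi in E_C and a white noise operator A, exp_chaos xi is in (E)_beta when
   beta < 1; the default value is then not used.  Likewise, S_inverse and
   convolution below choose the element with the defining property, which is
   unique for 0 <= beta < 1. *)
Definition exp_vector (xi : V * V) : X := insubd 0 (exp_chaos xi).

Definition S_transform (Psi : dual) (xi : V * V) : R[i] := Psi (exp_vector xi).

Definition S_inverse (F : V * V -> R[i]) : dual :=
  xget 0 [set Psi : dual | forall xi, testEC xi -> S_transform Psi xi = F xi].

Definition wick (Psi Theta : dual) : dual :=
  S_inverse (fun xi => S_transform Psi xi * S_transform Theta xi).

(* The dual operator of psi |-> phi <> psi, as an operator on (E)_beta. *)
Definition convolution (phi : dual) : lop :=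
  xget 0 [set T : lop | forall (psi : dual) (f : X), psi (T f) = wick phi psi f].

End TestTopology.

(* Main.v *)
From mathcomp Require Import all_boot all_order all_algebra fingroup perm.
From mathcomp Require Import all_classical all_reals all_analysis.
From mathcomp Require Import generic_quotient measurable_realfun complex ring lra.
Require Import Defs.

Set Implicit Arguments.
Unset Strict Implicit.
Unset Printing Implicit Defensive.

Import Order.TTheory GRing.Theory Num.Theory.
Import numFieldNormedType.Exports Normc.

Local Open Scope classical_set_scope.
Local Open Scope ring_scope.

(** The convolution operator has an explicit formula. Regard a test element [f] as a
    function on lists of vectors, and for a list [s] let [D_s f] be the test element
    [t |-> 'C(size s + size t, size s) f (s ++ t)], the annihilation operator of [s]
    divided by [(size s)!]. Then [(C_phi f) s = phi (D_s f)]; this is [conv], and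
    everything is read off from it.

    Algebra. Exponential vectors satisfy [D_s Phi_xi = Phi_xi(s) Phi_xi], hence
    [C_phi Phi_xi = S(phi)(xi) Phi_xi]. So [psi \o C_phi] has the [S]-transform
    [S(phi) S(psi)] and is the Wick product of [phi] and [psi], because the
    [S]-transform is injective ([wickE]); since evaluations at lists are continuous
    functionals, [conv phi] is the only operator with that property
    ([convolutionE]). Linearity is visible in the formula and multiplicativity
    follows by comparing [S]-transforms. As [D_[::]] is the identity, evaluation at
    the empty list composed with [C_phi] gives back [phi]: composition with that
    functional is a left inverse of the convolution map, and it is continuous for
    bounded convergence. This gives injectivity and the continuity of the inverse.

    Estimates. [A^p] maps its domain onto the whole space with inverse [B^p], so the
    [p]-th norm is a plain Hilbert-Schmidt norm for the inner product
    [<B^p x, B^p y>] ([tnorm2E]), and norms for different [p] are compared through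
    Bessel's inequality, slot by slot ([ssq_le_hs]). The spectral gap makes [B] a
    strict contraction, so a higher [p] dominates any exponential in the order of
    the chaos ([hs_gain]); that absorbs the binomial factors in
    [m! k! 'C(m + k, m)^2] ([weight_binomial], [chaos_contract]). By duality the
    [p]-th norm of [C_phi f] is the supremum of [phi] over test elements which stay
    bounded in every norm while [f] runs over a bounded set ([conv_fun_norm],
    [probe_bound]); this shows at the same time that [C_phi] is a continuous operator
    and that it depends continuously on [phi].

    Injectivity of the [S]-transform. Let a functional vanish on all exponential
    vectors. Shrinking [xi] along rays, it vanishes on all powers [xi^n], and by
    polarization on all symmetrized products of test vectors. These are dense: a
    kernel is nearly supported on the span of a finite orthonormal family, and the
    vectors of that family can be moved into the test space, as this is dense
    ([density], [functional_total]). Density of the test space is a Mittag-Leffler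
    argument ([testE_dense]) which uses that the range of [B] is dense and that the
    space of square-integrable functions is complete ([l2_fast_complete]). *)

(** * Moduli of complex numbers *)

Section Modulus.
Variable R : realType.
Implicit Types z : R[i].

Lemma sqr_normc z : normc z ^+ 2 = complex.Re z ^+ 2 + complex.Im z ^+ 2.
Proof. by case: z => a b; rewrite /normc sqr_sqrtr ?addr_ge0 ?sqr_ge0. Qed.

Lemma normc_ge0 z : 0 <= normc z.
Proof. by case: z => a b; exact: sqrtr_ge0. Qed.

Lemma normc_real (x : R) : normc x%:C%C = `|x|.
Proof. by rewrite /normc /= expr0n addr0 sqrtr_sqr. Qed.

Lemma normc_nat n : normc (n%:R : R[i]) = n%:R.
Proof. by rewrite -(rmorph_nat (real_complex R)) normc_real ger0_norm. Qed.

Lemma normc_sum (I : Type) (r : seq I) (F : I -> R[i]) :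
  normc (\sum_(i <- r) F i) <= \sum_(i <- r) normc (F i).
Proof.
elim: r => [|i r IH]; first by rewrite !big_nil normc0.
by rewrite !big_cons; apply: le_trans (le_normcD _ _) _; rewrite lerD2l.
Qed.

Lemma sum_cauchy_schwarz (I : Type) (r : seq I) (a b : I -> R) :
  (\sum_(i <- r) a i * b i) ^+ 2 <=
  (\sum_(i <- r) a i ^+ 2) * (\sum_(i <- r) b i ^+ 2).
Proof.
elim: r => [|i r]; first by rewrite !big_nil expr0n mulr0.
rewrite !big_cons.
have : 0 <= \sum_(j <- r) a j ^+ 2 by apply: sumr_ge0 => ? _; exact: sqr_ge0.
have : 0 <= \sum_(j <- r) b j ^+ 2 by apply: sumr_ge0 => ? _; exact: sqr_ge0.
move: (\sum_(j <- r) _ * _) (\sum_(j <- r) a j ^+ 2) (\sum_(j <- r) b j ^+ 2).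
move: (a i) (b i) => x y s A B B0 A0 sAB.
have h : 2 * (x * y * s) <= x ^+ 2 * B + A * y ^+ 2.
  have [B00|Bp] := eqVneq B 0.
    have : s ^+ 2 <= 0 by rewrite (le_trans sAB)// B00 mulr0.
    rewrite le_eqVlt ltNge sqr_ge0 orbF sqrf_eq0 => /eqP ->.
    by rewrite !mulr0 addr_ge0// mulr_ge0 ?sqr_ge0.
  have {}Bp : 0 < B by rewrite lt_def Bp.
  rewrite -(ler_pM2l Bp).
  have := sqr_ge0 (x * B - y * s); nra.
nra.
Qed.

Lemma normc_cauchy_schwarz (I : Type) (r : seq I) (a b : I -> R[i]) :
  normc (\sum_(i <- r) a i * b i) ^+ 2 <=
  (\sum_(i <- r) normc (a i) ^+ 2) * (\sum_(i <- r) normc (b i) ^+ 2).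
Proof.
have := normc_sum r (fun i => a i * b i).
under [X in _ <= X -> _]eq_bigr do rewrite normcM.
move=> h; apply: le_trans (sum_cauchy_schwarz _ _ _).
by rewrite lerXn2r ?nnegrE ?normc_ge0// sumr_ge0// => i _; rewrite mulr_ge0 ?normc_ge0.
Qed.

End Modulus.

(** * Inner products, Bessel families and orthonormalization *)

Section InnerProduct.
Variables (R : realType) (V : lmodType R).

Record inner_product (d : V -> V -> R) : Prop := InnerProduct {
  ip_sym : forall x y, d x y = d y x;
  ip_lin : forall a x y z, d (a *: x + y) z = a * d x z + d y z;
  ip_ge0 : forall x, 0 <= d x x;
  ip_eq0 : forall x, d x x = 0 -> x = 0 }.

Section Form.
Variables (d : V -> V -> R) (ipd : inner_product d).

Lemma ip0l x : d 0 x = 0.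
Proof. by have := ip_lin ipd 1 0 0 x; rewrite scaler0 addr0; lra. Qed.

Lemma ipDl x y z : d (x + y) z = d x z + d y z.
Proof. by rewrite -[x]scale1r (ip_lin ipd) mul1r scale1r. Qed.

Lemma ipZl a x z : d (a *: x) z = a * d x z.
Proof. by rewrite -[a *: x]addr0 (ip_lin ipd) ip0l !addr0. Qed.

Lemma ipBl x y z : d (x - y) z = d x z - d y z.
Proof. by rewrite ipDl -scaleN1r ipZl mulN1r. Qed.

Lemma ipDr x y z : d x (y + z) = d x y + d x z.
Proof. by rewrite !(ip_sym ipd x) ipDl. Qed.

Lemma ipZr a x z : d x (a *: z) = a * d x z.
Proof. by rewrite !(ip_sym ipd x) ipZl. Qed.

Lemma ipBr x y z : d x (y - z) = d x y - d x z.
Proof. by rewrite !(ip_sym ipd x) ipBl. Qed.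

Lemma ip0r x : d x 0 = 0.
Proof. by rewrite (ip_sym ipd) ip0l. Qed.

Lemma ip_suml (I : Type) (r : seq I) (F : I -> V) z :
  d (\sum_(i <- r) F i) z = \sum_(i <- r) d (F i) z.
Proof. by elim: r => [|i r IH]; rewrite ?big_nil ?ip0l// !big_cons ipDl IH. Qed.

Lemma ip_sumr (I : Type) (r : seq I) (F : I -> V) z :
  d z (\sum_(i <- r) F i) = \sum_(i <- r) d z (F i).
Proof. by rewrite (ip_sym ipd) ip_suml; apply: eq_bigr => i _; exact: ip_sym. Qed.

Lemma ip_cauchy_schwarz x y : d x y ^+ 2 <= d x x * d y y.
Proof.
have y0 := ip_ge0 ipd y.
have [yy|yy] := eqVneq (d y y) 0.
  by rewrite yy (ip_eq0 ipd yy) ip0r expr0n mulr0.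
have yp : 0 < d y y by rewrite lt_def yy.
have := ip_ge0 ipd (d y y *: x - d x y *: y).
rewrite ipBl !ipBr !ipZl !ipZr (ip_sym ipd y x) => h.
rewrite -(ler_pM2l yp); nra.
Qed.

Fixpoint orthoseq (xs : seq V) : Prop :=
  if xs is x :: xs' then
    [/\ d x x = 1, (forall y, y \in xs' -> d x y = 0) & orthoseq xs'] else True.

Definition proj (xs : seq V) (y : V) : V := \sum_(x <- xs) d x y *: x.

Lemma proj_linear xs a x y : proj xs (a *: x + y) = a *: proj xs x + proj xs y.
Proof.
rewrite /proj scaler_sumr -big_split/=; apply: eq_bigr => z _.
by rewrite ipDr ipZr scalerDl scalerA.
Qed.

Lemma ortho_proj xs x y : orthoseq xs -> x \in xs -> d x (proj xs y) = d x y.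
Proof.
rewrite /proj; elim: xs x => // z xs IH x [zz zx oxs].
rewrite inE big_cons ipDr ipZr => /predU1P[->|xxs].
  rewrite zz mulr1 ip_sumr big_seq big1 ?addr0// => i ixs.
  by rewrite ipZr zx// mulr0.
by rewrite IH// (ip_sym ipd x z) (zx _ xxs) mulr0 add0r.
Qed.

Lemma proj_id xs x : orthoseq xs -> x \in xs -> proj xs x = x.
Proof.
rewrite /proj; elim: xs x => // z xs IH x [zz zx oxs].
rewrite inE big_cons => /predU1P[->|xxs].
  rewrite zz scale1r big_seq big1 ?addr0// => i ixs.
  by rewrite (ip_sym ipd i) zx// scale0r.
by rewrite IH// zx// scale0r add0r.
Qed.

Lemma proj_orth xs y : (forall x, x \in xs -> d x y = 0) -> proj xs y = 0.
Proof. by move=> h; rewrite /proj big_seq big1// => i ixs; rewrite h// scale0r. Qed.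

Lemma ortho_comb xs (u : V -> R) : orthoseq xs ->
  d (\sum_(x <- xs) u x *: x) (\sum_(x <- xs) u x *: x) = \sum_(x <- xs) u x ^+ 2.
Proof.
elim: xs => [|x xs IH]; first by rewrite !big_nil ip0l.
move=> [xx xxs oxs]; rewrite !big_cons ipDl !ipDr IH// !ipZl !ipZr xx.
have h : d x (\sum_(y <- xs) u y *: y) = 0.
  by rewrite ip_sumr big_seq big1// => i ixs; rewrite ipZr xxs// mulr0.
by rewrite (ip_sym ipd _ x) h; ring.
Qed.

(** Bessel families with bound [c]. Unlike orthonormality, this survives a change of
    the inner product, at the cost of the constant. *)
Definition bessel (c : R) (xs : seq V) : Prop :=
  0 <= c /\ forall y, \sum_(x <- xs) d x y ^+ 2 <= c * d y y.

Lemma bessel1 x : bessel (d x x) [:: x].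
Proof.
split=> [|y]; first exact: (ip_ge0 ipd).
by rewrite big_seq1 ip_cauchy_schwarz.
Qed.

(** Gram-Schmidt, in the form of an extension of a given orthonormal family: the
    families met below need a common orthonormal system. *)
Lemma gram_schmidt e (ys : seq V) : orthoseq e ->
  exists e', orthoseq (e' ++ e) /\ forall y, y \in ys -> proj (e' ++ e) y = y.
Proof.
move=> oe; elim: ys => [|y ys [e' [oe' pe']]]; first by exists [::].
pose r := y - proj (e' ++ e) y.
have rx x : x \in e' ++ e -> d x r = 0.
  by move=> xe; rewrite /r ipBr ortho_proj// subrr.
have rx' x : x \in e' ++ e -> d r x = 0 by move=> xe; rewrite (ip_sym ipd) rx.
have [r0|r0] := eqVneq r 0.
  exists e'; split=> // z; rewrite inE => /predU1P[->|]; last exact: pe'.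
  by apply/esym/eqP; rewrite -subr_eq0 -/r r0.
have dr : 0 < d r r.
  rewrite lt_def (ip_ge0 ipd) andbT; apply: contra_neq r0 => rr.
  exact: (ip_eq0 ipd).
have sr : 0 < Num.sqrt (d r r) by rewrite sqrtr_gt0.
have sr0 := lt0r_neq0 sr.
exists ((Num.sqrt (d r r))^-1 *: r :: e') => /=; split.
  split=> //; last by move=> z ze; rewrite ipZl (rx' _ ze) mulr0.
  rewrite ipZl ipZr mulrA -expr2 exprVn sqr_sqrtr ?ltW// mulVf//.
  exact: lt0r_neq0.
have rr : d r y = d r r.
  rewrite /r [RHS]ipBr -/r [X in _ - X](_ : _ = 0) ?subr0// /proj.
  by rewrite ip_sumr big_seq big1// => i ie; rewrite ipZr (rx' _ ie) mulr0.
move=> z; rewrite inE /proj big_cons => /predU1P[->|zys].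
  rewrite -/(proj _ _) ipZl scalerA mulrAC -expr2 exprVn sqr_sqrtr ?ltW//.
  by rewrite rr mulVf ?lt0r_neq0// scale1r /r addrNK.
rewrite -/(proj _ _) -{1}(pe' _ zys) ipZl {1}/proj ip_sumr big_seq big1.
  by rewrite mulr0 scale0r add0r pe'.
by move=> i ie; rewrite ipZr (rx' _ ie) mulr0.
Qed.

(** [u] is represented on the span of [e] by [w = \sum_z (u z) *: z], and the
    squared norm of [w] is the right-hand sum. *)
Lemma bessel_functional c xs e (u : V -> R) : orthoseq e -> bessel c xs ->
  (forall x, x \in xs -> proj e x = x) ->
  (forall a x y, u (a *: x + y) = a * u x + u y) ->
  \sum_(x <- xs) u x ^+ 2 <= c * \sum_(z <- e) u z ^+ 2.
Proof.
move=> oe [c0 cxs] pe lu.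
have u0 : u 0 = 0 by have := lu 1 0 0; rewrite scaler0 addr0; lra.
have usum (I : Type) (r : seq I) (F : I -> R) (G : I -> V) :
    u (\sum_(i <- r) F i *: G i) = \sum_(i <- r) F i * u (G i).
  by elim: r => [|i r IH]; rewrite ?big_nil// !big_cons lu IH.
rewrite -(ortho_comb u oe); apply: le_trans (cxs _).
rewrite big_seq [leRHS]big_seq; apply: ler_sum => x xxs.
rewrite -{1}(pe _ xxs) /proj usum ip_sumr.
under [in leRHS]eq_bigr do rewrite ipZr mulrC (ip_sym ipd).
by [].
Qed.

End Form.

(** The synthesis map of a [d]-orthonormal family is an isometry into [d], so it
    has squared norm at most [c] into [d'], and so has its adjoint, the analysis
    map of [d']. *)
Lemma bessel_ortho (d d' : V -> V -> R) c xs :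
  inner_product d -> inner_product d' -> 0 <= c ->
  (forall x, d' x x <= c * d x x) -> orthoseq d xs -> bessel d' c xs.
Proof.
move=> ipd ipd' c0 dd oxs; split=> // y.
pose w := \sum_(x <- xs) d' x y *: x.
have := ip_cauchy_schwarz ipd' w y.
have -> : d' w y = \sum_(x <- xs) d' x y ^+ 2.
  by rewrite /w (ip_suml ipd'); apply: eq_bigr => x _; rewrite (ipZl ipd').
have := dd w; rewrite (ortho_comb ipd (fun x => d' x y) oxs).
have : 0 <= \sum_(x <- xs) d' x y ^+ 2 by apply: sumr_ge0 => ? _; exact: sqr_ge0.
move: (\sum_(x <- xs) _) => S S0 h1 h2.
have y0 := ip_ge0 ipd' y.
have [->|Sn] := eqVneq S 0; first exact: mulr_ge0.
have Sp : 0 < S by rewrite lt_def Sn.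
rewrite -(ler_pM2l Sp) -expr2; apply: le_trans h2 _.
by rewrite mulrA (mulrC S) ler_wpM2r.
Qed.

End InnerProduct.

(** * Hilbert-Schmidt norms of multilinear forms *)

Section Words.

(** The Cartesian product of a list of lists; [words (nseq n xs)] lists the index
    tuples of an [n]-fold sum over [xs]. *)
Fixpoint words (T : Type) (F : seq (seq T)) : seq (seq T) :=
  if F is xs :: F' then [seq x :: t | x <- xs, t <- words F'] else [:: [::]].

Lemma words_map (T U : Type) (g : T -> U) (F : seq (seq T)) :
  words [seq map g xs | xs <- F] = [seq map g s | s <- words F].
Proof.
elim: F => //= xs F ->; rewrite allpairs_mapl allpairs_mapr map_allpairs.
by apply: eq_allpairs.
Qed.

Lemma size_words (T : eqType) (F : seq (seq T)) s :
  s \in words F -> size s = size F.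
Proof.
elim: F s => [|xs F IH] s /=; first by rewrite inE => /eqP ->.
by move=> /allpairsP[[x t] /= [_ /IH st ->]] /=; rewrite st.
Qed.

Lemma mem_words_nseq (T : eqType) n (xs : seq T) s :
  (s \in words (nseq n xs)) = (size s == n) && all [in xs] s.
Proof.
elim: n s => [|n IH] [|x s] //=.
  by apply/negbTE/negP => /allpairsP[[? ?] []].
apply/allpairsP/idP => [[[y t] /= [yx + [-> ->]]]|/andP[/eqP [sn] /andP[xx sx]]].
  by rewrite IH eqSS yx.
by exists (x, s); split => //=; rewrite IH sn eqxx.
Qed.

Lemma words_uniq (T : eqType) (F : seq (seq T)) :
  (forall xs, xs \in F -> uniq xs) -> uniq (words F).
Proof.
elim: F => //= xs F IH h; apply: allpairs_uniq.
- by apply: h; rewrite mem_head.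
- by apply: IH => ys yF; apply: h; rewrite inE yF orbT.
- by move=> [x s] [y t] _ _ /= [-> ->].
Qed.

Variable (M : nmodType).

Lemma sum_words_cons (T : Type) xs (F : seq (seq T)) (G : seq T -> M) :
  \sum_(s <- words (xs :: F)) G s =
  \sum_(x <- xs) \sum_(s <- words F) G (x :: s).
Proof. by rewrite /= big_allpairs_dep. Qed.

Lemma sum_words_nil (T : Type) (G : seq T -> M) :
  \sum_(s <- words [::]) G s = G [::].
Proof. exact: big_seq1. Qed.

Lemma sum_words_cat (T : Type) (F F' : seq (seq T)) (G : seq T -> M) :
  \sum_(s <- words (F ++ F')) G s =
  \sum_(s <- words F) \sum_(t <- words F') G (s ++ t).
Proof.
elim: F G => [|xs F IH] G; first by rewrite sum_words_nil.
by rewrite cat_cons !sum_words_cons; apply: eq_bigr => x _; rewrite IH.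
Qed.

Lemma sum_words_tuple (T : finType) n (G : seq T -> M) :
  \sum_(s <- words (nseq n (enum T))) G s = \sum_(j : n.-tuple T) G j.
Proof.
rewrite -big_enum -(big_map (@tval n T) xpredT)/=; apply: perm_big; apply: uniq_perm.
- by apply: words_uniq => xs; rewrite mem_nseq => /andP[_ /eqP ->]; exact: enum_uniq.
- by rewrite map_inj_uniq ?enum_uniq//; exact: val_inj.
move=> s; rewrite mem_words_nseq; apply/andP/mapP => [[/eqP sn _]|[t _ ->]].
  by exists (Tuple (introT eqP sn)) => //; rewrite mem_enum.
by rewrite size_tuple eqxx; split=> //; apply/allP => x _; rewrite mem_enum.
Qed.

End Words.

Section HilbertSchmidt.
Variables (R : realType) (V : lmodType R).
Local Notation C := (R[i]^o).
Implicit Types (f : seq V -> C) (d : V -> V -> R).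

Lemma multilinear_cat f s : multilinear f -> multilinear (fun t => f (s ++ t)).
Proof. by move=> fm t u a x y; rewrite !catA fm. Qed.

Lemma multilinear_cons f x : multilinear f -> multilinear (fun t => f (x :: t)).
Proof. exact: (multilinear_cat [:: x]). Qed.

Definition ssq (F : seq (seq V)) f : R := \sum_(s <- words F) normc (f s) ^+ 2.

Lemma ssq_ge0 F f : 0 <= ssq F f.
Proof. by apply: sumr_ge0 => s _; exact: sqr_ge0. Qed.

Lemma ssq_cons xs F f : ssq (xs :: F) f = \sum_(x <- xs) ssq F (fun t => f (x :: t)).
Proof. exact: sum_words_cons. Qed.

Lemma sum_normc_bessel d c xs e (g : V -> C) : inner_product d -> orthoseq d e ->
  bessel d c xs -> (forall x, x \in xs -> proj d e x = x) ->
  (forall a x y, g (a *: x + y) = a%:C%C * g x + g y) ->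
  \sum_(x <- xs) normc (g x) ^+ 2 <= c * \sum_(z <- e) normc (g z) ^+ 2.
Proof.
move=> ipd oe cxs pe lg.
under eq_bigr do rewrite sqr_normc.
under [in leRHS]eq_bigr do rewrite sqr_normc.
rewrite !big_split/= mulrDr; apply: lerD.
  apply: (bessel_functional ipd) => // a x y; rewrite lg.
  by case: (g x) (g y) => [? ?] [? ?] /=; ring.
apply: (bessel_functional ipd) => // a x y; rewrite lg.
by case: (g x) (g y) => [? ?] [? ?] /=; ring.
Qed.

Lemma ssq_span d (F : seq (R * seq V)) e f : inner_product d -> orthoseq d e ->
  (forall cx, cx \in F -> bessel d cx.1 cx.2) ->
  (forall cx x, cx \in F -> x \in cx.2 -> proj d e x = x) ->
  multilinear f ->
  ssq [seq cx.2 | cx <- F] f <= (\prod_(cx <- F) cx.1) * ssq (nseq (size F) e) f.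
Proof.
move=> ipd oe; elim: F f => [|[c xs] F IH] f /= Fb Fp fm.
  by rewrite big_nil mul1r.
have [c0 bc] : bessel d c xs by apply: (Fb (c, xs)); rewrite mem_head.
have P0 : 0 <= \prod_(cx <- F) cx.1.
  rewrite big_seq prodr_ge0// => cx cxF.
  by have [] : bessel d cx.1 cx.2 by apply: Fb; rewrite inE cxF orbT.
rewrite !ssq_cons big_cons.
apply: (@le_trans _ _ (\sum_(x <- xs)
   (\prod_(cx <- F) cx.1) * ssq (nseq (size F) e) (fun t => f (x :: t)))).
  apply: ler_sum => x _; apply: IH; last exact: multilinear_cons.
    by move=> cx cxF; apply: Fb; rewrite inE cxF orbT.
  by move=> cx y cxF; apply: Fp; rewrite inE cxF orbT.
rewrite -mulr_sumr [(c, xs).1 * _]mulrC -mulrA ler_wpM2l//=.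
rewrite /ssq exchange_big [X in c * X]exchange_big/= mulr_sumr.
apply: ler_sum => s _.
apply: (sum_normc_bessel ipd oe (conj c0 bc)); last by move=> a x y; exact: (fm [::]).
by move=> x; apply: (Fp (c, xs)); rewrite mem_head.
Qed.

(** The squared Hilbert-Schmidt norm of the [n]-linear part of [f], for the inner
    product [d]. *)
Definition hs d n f : \bar R :=
  ereal_sup [set x | exists2 zs, orthoseq d zs & x = (ssq (nseq n zs) f)%:E].

Lemma hs_ge d n f zs : orthoseq d zs -> ((ssq (nseq n zs) f)%:E <= hs d n f)%E.
Proof. by move=> ozs; apply: ereal_sup_ubound; exists zs. Qed.

Lemma hs_ge0 d n f : (0 <= hs d n f)%E.
Proof.
by apply: le_trans (@hs_ge d n f [::] _) => //; rewrite lee_fin ssq_ge0.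
Qed.

Lemma hs_le d n f y :
  (forall zs, orthoseq d zs -> ((ssq (nseq n zs) f)%:E <= y)%E) -> (hs d n f <= y)%E.
Proof. by move=> h; apply: ub_ereal_sup => _ [zs ozs ->]; exact: h. Qed.

Lemma eq_ssq_size F f g : (forall s, size s = size F -> f s = g s) ->
  ssq F f = ssq F g.
Proof.
by move=> fg; rewrite /ssq; apply: eq_big_seq => s sF; rewrite fg// (size_words sF).
Qed.

Lemma eq_hs d n f g : (forall s, size s = n -> f s = g s) -> hs d n f = hs d n g.
Proof.
move=> fg; rewrite /hs; congr (ereal_sup _); apply/seteqP; split=> _ [zs oz ->];
by exists zs => //; congr EFin; apply: eq_ssq_size => s;
  rewrite size_nseq => sn; rewrite fg.
Qed.

(** Orthonormalize all the families together and apply Bessel's inequality slot by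
    slot. This is the source of every comparison of norms below, since it allows
    different families in different slots. *)
Lemma ssq_le_hs d (F : seq (R * seq V)) f : inner_product d ->
  (forall cx, cx \in F -> bessel d cx.1 cx.2) -> multilinear f ->
  ((ssq [seq cx.2 | cx <- F] f)%:E <=
   (\prod_(cx <- F) cx.1)%:E * hs d (size F) f)%E.
Proof.
move=> ipd Fb fm.
have [e] := gram_schmidt ipd (flatten [seq cx.2 | cx <- F]) (I : orthoseq d [::]).
rewrite cats0 => -[oe pe].
have P0 : 0 <= \prod_(cx <- F) cx.1.
  by rewrite big_seq prodr_ge0// => cx /Fb[].
apply: (@le_trans _ _ ((\prod_(cx <- F) cx.1)%:E * (ssq (nseq (size F) e) f)%:E)%E).
  rewrite -EFinM lee_fin; apply: (ssq_span ipd) => // cx x cxF xcx.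
  by apply: pe; apply/flatten_mapP; exists cx.
by apply: lee_wpmul2l; [rewrite lee_fin|exact: hs_ge].
Qed.

Lemma prod_nseq n (cx : R * seq V) : \prod_(i <- nseq n cx) i.1 = cx.1 ^+ n.
Proof. by elim: n => [|n IH] /=; rewrite ?big_nil// big_cons IH exprS. Qed.

Lemma hs_compare d d' c n f : inner_product d -> inner_product d' -> 0 <= c ->
  (forall x, d' x x <= c * d x x) -> multilinear f ->
  (hs d n f <= (c ^+ n)%:E * hs d' n f)%E.
Proof.
move=> ipd ipd' c0 dd fm; apply: hs_le => zs ozs.
have := @ssq_le_hs d' (nseq n (c, zs)) f ipd'.
rewrite map_nseq size_nseq prod_nseq => /(_ _ fm); apply.
move=> cx; rewrite mem_nseq => /andP[_ /eqP ->] /=.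
exact: (bessel_ortho ipd ipd').
Qed.

End HilbertSchmidt.

(** * Powers of the operator *)

Section OrthonormalFamilies.
Variables (R : realType) (V : lmodType R) (d : V -> V -> R).
Hypothesis ipd : inner_product d.

Lemma orthonormal_orthoseq (I : eqType) (r : seq I) (h : I -> V) :
  uniq r -> orthonormal d h -> orthoseq d [seq h i | i <- r].
Proof.
move=> + oh; elim: r => //= i r IH /andP[ir ur]; split; last exact: IH.
  by rewrite oh eqxx.
move=> _ /mapP[j jr ->]; rewrite oh; case: eqP => // ij.
by rewrite ij jr in ir.
Qed.

Lemma orthoseq_nth zs i j : orthoseq d zs -> (i < size zs)%N -> (j < size zs)%N ->
  d zs`_i zs`_j = (i == j)%:R.
Proof.
elim: zs i j => // z zs IH [|i] [|j] [zz zzs oz] //=; rewrite !ltnS => il jl.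
- by rewrite zzs ?mem_nth.
- by rewrite (ip_sym ipd) zzs ?mem_nth.
- by rewrite IH// eqSS.
Qed.

End OrthonormalFamilies.

Section Powers.
Variables (R : realType) (V : lmodType R) (dot : V -> V -> R).
Variables (A : unbounded V) (B : V -> V).
Hypothesis ipd : inner_product dot.
Hypothesis invB : inverse_op A B.
Hypothesis linB : forall a x y, B (a *: x + y) = a *: B x + B y.

Lemma iter_linear p a x y :
  iter p B (a *: x + y) = a *: iter p B x + iter p B y.
Proof. by elim: p => //= p ->. Qed.

Lemma iter0 p : iter p B 0 = 0.
Proof. by have := iter_linear p (-1) 0 0; rewrite !scaleN1r !addNr. Qed.

Lemma iter_eq0 p x : iter p B x = 0 -> x = 0.
Proof.
have [AB BA] := invB.
have B0 : B 0 = 0 := iter0 1.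
have inj y : B y = 0 -> y = 0.
  by move=> y0; rewrite -[y](AB _).2 y0 -{1}B0 (AB _).2.
by elim: p => //= p IH /inj /IH.
Qed.

Lemma dom_pow_iter p z : dom_pow A p (iter p B z).
Proof. by have [AB _] := invB; elim: p => //= p IH; rewrite (AB _).2; split => //; exact: (AB _).1. Qed.

Lemma iterAB p z : iter p A (iter p B z) = z.
Proof. by have [AB _] := invB; elim: p => // p IH; rewrite iterSr iterS (AB _).2. Qed.

Lemma iterBA p x : dom_pow A p x -> iter p B (iter p A x) = x.
Proof.
have [_ BA] := invB.
by elim: p x => // p IH x /= [Ax pAx]; rewrite -[A (iter p A x)]iterS iterSr IH// BA.
Qed.

Lemma dom_powE p x : dom_pow A p x <-> exists z, x = iter p B z.
Proof.
split=> [px|[z ->]]; last exact: dom_pow_iter.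
by exists (iter p A x); rewrite iterBA.
Qed.

Lemma testE_comb a x y : testE A x -> testE A y -> testE A (a *: x + y).
Proof.
move=> Ex Ey p; have /dom_powE[z ->] := Ex p; have /dom_powE[w ->] := Ey p.
by apply/dom_powE; exists (a *: z + w); rewrite iter_linear.
Qed.

Lemma testE0 : testE A 0.
Proof. by move=> p; apply/dom_powE; exists 0; rewrite iter0. Qed.

Lemma testE_iter q x : testE A x -> testE A (iter q B x).
Proof.
move=> Ex p; have /dom_powE[z ->] := Ex p; apply/dom_powE.
by exists (iter q B z); rewrite -!iterD addnC.
Qed.

Definition dotp p x y : R := dot (iter p B x) (iter p B y).

Lemma dotp_ip p : inner_product (dotp p).
Proof.
split; rewrite /dotp.
- by move=> x y; rewrite (ip_sym ipd).
- by move=> a x y z; rewrite iter_linear (ip_lin ipd).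
- by move=> x; exact: (ip_ge0 ipd).
- by move=> x /(ip_eq0 ipd) /iter_eq0.
Qed.

(** [A^p] maps its domain bijectively onto the whole space, with inverse [B^p]; so
    the [p]-th norm of a form is its plain Hilbert-Schmidt norm for the weaker
    inner product [dotp p]. *)
Lemma tnorm2E p n (f : seq V -> R[i]^o) : tnorm2 dot A p n f = hs (dotp p) n f.
Proof.
rewrite /tnorm2 /hs; congr ereal_sup; apply/seteqP; split.
  move=> _ [k [h [hA oh ->]]] /=; exists [seq iter p A (h i) | i <- enum 'I_k].
    apply: orthonormal_orthoseq; first exact: enum_uniq.
    by move=> i j; rewrite /dotp !iterBA.
  congr EFin; rewrite /ssq -map_nseq words_map big_map.
  by rewrite -(sum_words_tuple n (fun s => normc (f [seq iter p A (h i) | i <- s]) ^+ 2)).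
move=> _ [zs ozs ->] /=; exists (size zs), (fun i => iter p B zs`_i); split.
- by move=> i; exact: dom_pow_iter.
- by move=> i j; rewrite -[LHS]/(dotp p _ _) (orthoseq_nth (dotp_ip p)).
congr EFin; rewrite (eq_bigr (fun j : _.-tuple _ =>
  normc (f [seq zs`_(val i) | i <- j]) ^+ 2)); last first.
  by move=> j _; congr (normc (f _) ^+ 2); apply: eq_map => i; rewrite iterAB.
rewrite -(sum_words_tuple n (fun s => normc (f [seq zs`_(val i) | i <- s]) ^+ 2)).
rewrite /ssq -{1}(mkseq_nth 0 zs) /mkseq -val_enum_ord -map_comp.
by rewrite -map_nseq words_map big_map.
Qed.

Variable kappa : R.
Hypothesis kappa_ge0 : 0 <= kappa.
Hypothesis contrB : forall x, dot (B x) (B x) <= kappa * dot x x.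

Lemma dotp_le p r x : dotp (p + r) x x <= kappa ^+ r * dotp p x x.
Proof.
rewrite /dotp addnC; elim: r => [|r IH]; first by rewrite mul1r.
rewrite addSn iterS exprS; apply: le_trans (contrB _) _.
by rewrite -mulrA ler_wpM2l.
Qed.

Lemma hs_dotp_le p r n f : multilinear f ->
  (hs (dotp p) n f <= (kappa ^+ (r * n))%:E * hs (dotp (p + r)) n f)%E.
Proof.
move=> fm; rewrite exprM; apply: hs_compare => //; try exact: dotp_ip.
  exact: exprn_ge0.
by move=> x; exact: dotp_le.
Qed.

End Powers.

(** * The spectral gap *)

Section SpectralGap.
Variables (R : realType) (V : lmodType R) (dot : V -> V -> R).
Variable A : unbounded V.
Hypothesis ipd : inner_product dot.
Hypothesis linA : linear_op A.
Hypothesis saA : self_adjoint dot A.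

Lemma self_adjoint_sym x y : dom A x -> dom A y -> dot (A x) y = dot x (A y).
Proof.
by move=> Ax Ay; have [_ h] := saA y (A y); apply: h.
Qed.

Definition form_ge (l : R) := forall x, dom A x -> l * dot x x <= dot (A x) x.

(** Lower bounds of the form can be raised as long as they stay in the resolvent set:
    if [T = (A - l)^-1] has norm at most [K], then the positivity of [A - l] on the
    vector [T x - K x] gives [|x|^2 <= K <(A - l) x, x>]. *)
Lemma form_ge_step l : form_ge l -> resolvent_set dot A l ->
  exists2 e, 0 < e & form_ge (l + e).
Proof.
move=> Al [T [TA AT] [K TK]].
pose K' := `|K| + 1; have K0 : 0 < K' by rewrite ltr_wpDl.
exists K'^-1; first by rewrite invr_gt0.
move=> x Ax; pose w := T x; have [Aw Ew] := TA x.
have N0 := ip_ge0 ipd x.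
have wK : dot w w <= K' ^+ 2 * dot x x.
  have h : norm0 dot w <= K' * norm0 dot x.
    apply: le_trans (TK x) _; rewrite ler_wpM2r ?sqrtr_ge0//.
    by rewrite /K' (le_trans (ler_norm _))// lerDl.
  rewrite -[dot w w]sqr_sqrtr ?(ip_ge0 ipd)// -[dot x x]sqr_sqrtr// -exprMn.
  by rewrite lerXn2r ?nnegrE ?mulr_ge0 ?sqrtr_ge0// ltW.
have xw : dot x w <= K' * dot x x.
  rewrite leNgt; apply/negP => h.
  have := ip_cauchy_schwarz ipd x w.
  have : 0 <= K' * dot x x by rewrite mulr_ge0// ltW.
  nra.
have [_ linA'] := linA.
have [Au Eu] := linA' (- K') x w Ax Aw.
have := Al _ Au; rewrite Eu => {Al}.
have Ew' : A w = x + l *: w by rewrite -[x in RHS]Ew /= subrK.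
have sym : dot (A x) w = dot x x + l * dot x w.
  by rewrite (self_adjoint_sym Ax Aw) Ew' (ipDr ipd) (ipZr ipd).
rewrite !(ipDl ipd) !(ipZl ipd) !(ipDr ipd) !(ipZr ipd) sym Ew'.
rewrite !(ipDl ipd) !(ipZl ipd) (ip_sym ipd w x) => h.
rewrite mulrDl -lerBrDl mulrC ler_pdivrMr//.
rewrite -(ler_pM2l K0); nra.
Qed.

Lemma form_ge_le l l' : l' <= l -> form_ge l -> form_ge l'.
Proof.
by move=> ll h x Ax; apply: le_trans (h _ Ax); rewrite ler_wpM2r// (ip_ge0 ipd).
Qed.

(** The largest lower bound below [c] is [c] itself, by [form_ge_step]. This replaces
    the spectral theorem. *)
Lemma form_gap c : positive_op dot A -> 0 <= c ->
  (forall l, l <= c -> resolvent_set dot A l) -> form_ge c.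
Proof.
move=> posA c0 rA.
pose S := [set l | l <= c /\ form_ge l].
have S0 : S 0 by split=> // x Ax; rewrite mul0r; exact: posA.
have Sc : ubound S c by move=> l [].
have hS : has_sup S by split; [exists 0|exists c].
have ls : form_ge (sup S).
  move=> x Ax; have [x0|x0] := eqVneq (dot x x) 0.
    by rewrite (ip_eq0 ipd x0) (ip0r ipd) mulr0 (ip0r ipd).
  have xp : 0 < dot x x by rewrite lt_def x0 (ip_ge0 ipd).
  rewrite -ler_pdivlMr//; apply: ge_sup; first by exists 0.
  by move=> l [_ Sl]; rewrite ler_pdivlMr//; exact: Sl.
have sc : sup S <= c by apply: ge_sup => //; exists 0.
have [e e0 se] := form_ge_step ls (rA _ sc).
have [le|lt] := leP (sup S + e) c; last exact: form_ge_le (ltW lt) se.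
suff : sup S + e <= sup S by rewrite gerDl leNgt e0.
by apply: ub_le_sup; [exists c|split].
Qed.

Lemma spectrum_gap : positive_op dot A ->
  (1 < ereal_inf (EFin @` spectrum dot A))%E -> exists2 c, 1 < c & form_ge c.
Proof.
move=> posA gap.
suff [c c1 cA] : exists2 c : R, 1 < c & (c%:E < ereal_inf (EFin @` spectrum dot A))%E.
  exists c => //; apply: form_gap => //; first by rewrite ltW// (lt_trans _ c1).
  move=> l lc; apply: contrapT => nl.
  have : (ereal_inf (EFin @` spectrum dot A) <= l%:E)%E.
    by apply: ereal_inf_lbound; exists l.
  by move=> /(lt_le_trans cA); rewrite lte_fin ltNge lc.
move: gap; case: (ereal_inf _) => [r| |]//.
  by rewrite lte_fin => r1; exists ((1 + r) / 2); rewrite ?lte_fin; lra.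
by move=> _; exists 2; rewrite ?ltry// ltr1n.
Qed.

Lemma inverse_contraction B c : 0 < c -> form_ge c -> inverse_op A B ->
  forall x, dot (B x) (B x) <= (c ^- 2) * dot x x.
Proof.
move=> c0 cA [AB _] x; have [Bx ABx] := AB x.
have := cA _ Bx; rewrite ABx => h1.
have h2 := ip_cauchy_schwarz ipd x (B x).
have N0 := ip_ge0 ipd (B x).
rewrite mulrC ler_pdivlMr ?exprn_gt0//.
have [->|n0] := eqVneq (dot (B x) (B x)) 0; first by rewrite mul0r (ip_ge0 ipd).
have Np : 0 < dot (B x) (B x) by rewrite lt_def n0.
rewrite -(ler_pM2r Np); apply: le_trans h2.
have : 0 <= c * dot (B x) (B x) by rewrite mulr_ge0// ltW.
nra.
Qed.

Lemma inverse_sym B : inverse_op A B -> forall x y, dot (B x) y = dot x (B y).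
Proof.
move=> [AB _] x y; have [Bx ABx] := AB x; have [By ABy] := AB y.
by rewrite -{1}ABy -{2}ABx (self_adjoint_sym Bx By).
Qed.

Lemma inverse_linear B : inverse_op A B ->
  forall a x y, B (a *: x + y) = a *: B x + B y.
Proof.
move=> [AB BA] a x y; have [Bx ABx] := AB x; have [By ABy] := AB y.
have [_ /(_ a _ _ Bx By) [d e]] := linA.
by rewrite -[RHS]BA// e ABx ABy.
Qed.

End SpectralGap.

(** * Density of the test vectors *)

Section Density.
Variables (R : realType) (V : lmodType R) (dot : V -> V -> R).
Variables (A : unbounded V) (B : V -> V).
Hypothesis ipd : inner_product dot.
Hypothesis invB : inverse_op A B.
Hypothesis linB : forall a x y, B (a *: x + y) = a *: B x + B y.
Hypothesis contrB : forall x, dot (B x) (B x) <= dot x x.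
Hypothesis denseA : densely_defined dot A.

Local Notation nrm := (norm0 dot).

Lemma norm0_ge0 x : 0 <= nrm x. Proof. exact: sqrtr_ge0. Qed.

Lemma sqr_norm0 x : nrm x ^+ 2 = dot x x.
Proof. by rewrite sqr_sqrtr// (ip_ge0 ipd). Qed.

Lemma norm0D x y : nrm (x + y) <= nrm x + nrm y.
Proof.
rewrite -(@ler_pXn2r _ 2)// ?nnegrE ?addr_ge0 ?norm0_ge0//.
rewrite sqrrD !sqr_norm0 !(ipDl ipd) !(ipDr ipd) (ip_sym ipd y x).
suff : dot x y <= nrm x * nrm y by lra.
rewrite leNgt; apply/negP => h; have := ip_cauchy_schwarz ipd x y.
rewrite -!sqr_norm0 -exprMn; move: h.
have := mulr_ge0 (norm0_ge0 x) (norm0_ge0 y); move: (nrm x * nrm y) => m; nra.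
Qed.

Lemma norm0N x : nrm (- x) = nrm x.
Proof. by rewrite /norm0 -scaleN1r (ipZl ipd) (ipZr ipd) !mulN1r opprK. Qed.

Lemma norm0_eq0 x : nrm x = 0 -> x = 0.
Proof. by move=> x0; apply: (ip_eq0 ipd); rewrite -sqr_norm0 x0 expr0n. Qed.

Lemma norm0B x y z : nrm (x - z) <= nrm (x - y) + nrm (y - z).
Proof. by rewrite (le_trans _ (norm0D _ _))// addrA subrK. Qed.

Lemma norm0_iter n x : nrm (iter n B x) <= nrm x.
Proof.
elim: n => //= n; apply: le_trans.
by rewrite -(@ler_pXn2r _ 2)// ?nnegrE ?norm0_ge0// !sqr_norm0.
Qed.

Lemma iterB n x y : iter n B (x - y) = iter n B x - iter n B y.
Proof. by rewrite addrC -scaleN1r (iter_linear linB) scaleN1r addrC. Qed.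

(** Completeness, for fast Cauchy sequences and with the rate that telescoping
    gives. *)
Definition fast_complete := forall (e : R) (u : nat -> V), 0 < e ->
  (forall n, nrm (u n.+1 - u n) <= e * 2 ^- n) ->
  exists x, forall n, nrm (x - u n) <= 2 * e * 2 ^- n.

Lemma le_geometric_eq0 (a c : R) : 0 <= a -> (forall n, a <= c * 2 ^- n) -> a = 0.
Proof.
move=> a0 h; apply/eqP; apply: contraTT isT => an0.
have ap : 0 < a by rewrite lt_def an0.
have /archi_boundP : 0 <= c / a.
  by rewrite divr_ge0//; have := h 0%N; rewrite expr0 invr1 mulr1; exact: le_trans.
set n := Num.bound _ => cn; have := h n.
rewrite ler_pdivlMr ?exprn_gt0// leNgt; apply: contraNN => _.
move: cn; rewrite ltr_pdivrMr// mulrC => /lt_le_trans; apply.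
by rewrite ler_pM2l// -natrX ler_nat ltnW// ltn_expl.
Qed.

(** The Mittag-Leffler argument: approximate [x] by [B y_1] with [B] of dense range,
    then [y_1] by [B y_2], and so on, with geometrically small errors. The points
    [B^n y_n] converge and their limit is, for each [p], the image under [B^p] of
    the limit of [B^n y_(n + p)]. *)
Lemma testE_dense : fast_complete ->
  forall x (e : R), 0 < e -> exists2 y, testE A y & nrm (x - y) <= e.
Proof.
move=> complete x e' e'0; pose e := e' / 2; have e0 : 0 < e by rewrite divr_gt0.
have approx y k : exists z, nrm (y - B z) <= e * 2 ^- k.
  have ek : 0 < e * 2 ^- k by rewrite mulr_gt0// invr_gt0 exprn_gt0.
  have [w Aw wy] := denseA y ek.
  by exists (A w); have [_ BA] := invB; rewrite BA// ltW.
pose next (y : V) k := projT1 (cid (approx y k)).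
have nextP y k : nrm (y - B (next y k)) <= e * 2 ^- k := projT2 (cid (approx y k)).
pose y := fix y n := if n is m.+1 then next (y m) m else x.
have yP n : nrm (B (y n.+1) - y n) <= e * 2 ^- n by rewrite -norm0N opprB; exact: nextP.
have lim p : exists z, forall n, nrm (z - iter n B (y (n + p)%N)) <= 2 * e * 2 ^- n.
  apply: complete => // n; rewrite iterSr -iterB addSn.
  apply: le_trans (norm0_iter _ _) _; apply: le_trans (yP _) _.
  by rewrite ler_pM2l// lef_pV2 ?posrE ?exprn_gt0// ler_eXn2l ?ltr1n// leq_addr.
pose z p := projT1 (cid (lim p)).
have zP p n : nrm (z p - iter n B (y (n + p)%N)) <= 2 * e * 2 ^- n := projT2 (cid (lim p)) n.
have Bz p : z p = B (z p.+1).
  apply/eqP; rewrite -subr_eq0; apply/eqP/norm0_eq0.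
  apply: (@le_geometric_eq0 _ (4 * e)); first exact: norm0_ge0.
  move=> n; apply: le_trans (norm0B _ (iter n.+1 B (y (n.+1 + p)%N)) _) _.
  have h1 := zP p n.+1; have h2 := zP p.+1 n.
  have h3 : nrm (iter n.+1 B (y (n.+1 + p)%N) - B (z p.+1)) <= 2 * e * 2 ^- n.
    rewrite addSnnS iterS -[X in X - _]/(iter 1 B _) -[X in _ - X]/(iter 1 B _) -iterB.
    by rewrite (le_trans (norm0_iter _ _))// -norm0N opprB.
  apply: (@le_trans _ _ (2 * e * 2 ^- n + 2 * e * 2 ^- n)); last by rewrite -mulrDl; lra.
  apply: lerD h3; apply: le_trans h1 _; rewrite ler_pM2l ?mulr_gt0//.
  by rewrite lef_pV2 ?posrE ?exprn_gt0// ler_eXn2l ?ltr1n.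
exists (z 0%N).
  move=> p; apply/(dom_powE invB); exists (z p).
  by elim: p => // p {1}->; rewrite {1}Bz iterSr.
by have := zP 0%N 0%N; rewrite -norm0N opprB expr0 invr1 mulr1 /= /e mulrC divfK.
Qed.

End Density.

(** * Completeness of the space of square-integrable functions *)

Section L2InnerProduct.
Local Open Scope quotient_scope.
Variable R : realType.
Local Notation mu := (@lebesgue_measure R : {measure set _ -> \bar R}).
Local Notation sqint := (LfunType mu (le1_2 R)).
Implicit Types f g h : sqint.

Lemma sqint_mul_integrable f g :
  mu.-integrable setT (EFin \o (fun x => (f : R -> R) x * (g : R -> R) x)).
Proof. by apply/Lfun1_integrable; apply: Lfun2_mul_Lfun1; exact: LfunP. Qed.

Lemma repr_pi_ae f :
  {ae mu, forall x, (repr (\pi_(L2 R) f) : R -> R) x = (f : R -> R) x}.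
Proof.
have : repr (\pi_(L2 R) f) - f \in ae0 (R:=R) by rewrite Quotient.idealrBE reprK.
move=> /ae0P; apply: (@filterS _ _ (ae_filter_ringOfSetsType mu)) => x /eqP.
by rewrite subr_eq0 => /eqP.
Qed.

Lemma sqint_measurable f : measurable_fun setT (f : R -> R).
Proof. by have := LfunP f; rewrite inE => /andP[+ _]; rewrite inE. Qed.
Hint Resolve sqint_measurable : core.

Lemma l2dot_pi f g : l2dot (\pi_(L2 R) f) (\pi_(L2 R) g) =
  (\int[mu]_t ((f : R -> R) t * (g : R -> R) t))%R.
Proof.
rewrite /l2dot /Rintegral; congr fine; apply: ae_eq_integral => //.
- exact: measurable_int (sqint_mul_integrable _ _).
- exact: measurable_int (sqint_mul_integrable _ _).
have := repr_pi_ae f; have := repr_pi_ae g.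
by apply: (@filterS2 _ _ (ae_filter_ringOfSetsType mu)) => x -> -> .
Qed.

Lemma l2dot_ip : inner_product (@l2dot R).
Proof.
split.
- by move=> x y; apply: eq_Rintegral => t _; rewrite mulrC.
- move=> a x y z; have [f ->] := l2_pi x; have [g ->] := l2_pi y.
  have [h ->] := l2_pi z.
  have -> : a *: \pi_(L2 R) f + \pi_(L2 R) g = \pi_(L2 R) (a *: f + g).
    by rewrite l2_piD -l2scale_pi.
  rewrite !l2dot_pi -RintegralZl//; last exact: sqint_mul_integrable.
  rewrite -RintegralD//; last exact: sqint_mul_integrable.
    apply: eq_Rintegral => t _.
    by rewrite -[X in X * _ = _]/(a * (f : R -> R) t + (g : R -> R) t) mulrDl mulrA.
  rewrite (_ : _ \o _ = EFin \o (fun x => ((a *: f : sqint) : R -> R) x * (h : R -> R) x)).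
    exact: sqint_mul_integrable.
  by apply/funext => t /=; rewrite mulrA.
- by move=> x; apply: Rintegral_ge0 => t _; rewrite -expr2 sqr_ge0.
move=> x; have [f ->] := l2_pi x; rewrite l2dot_pi => f0.
have -> : 0 = \pi_(L2 R) 0 by apply: (addrI (\pi_(L2 R) 0)); rewrite addr0 -l2_piD addr0.
apply/eqP; rewrite -Quotient.idealrBE subr0; apply/ae0P.
have fi := sqint_mul_integrable f f.
have : (\int[mu]_(t in setT) `|((f : R -> R) t * (f : R -> R) t)%:E| = 0)%E.
  have : (\int[mu]_(t in setT) ((f : R -> R) t * (f : R -> R) t)%:E = 0)%E.
    by rewrite -[LHS]fineK ?[fine _]f0//; exact: integrable_fin_num fi.
  move=> h; rewrite -[RHS]h; apply: eq_integral => t _.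
  by rewrite /= ger0_norm// -expr2 sqr_ge0.
move=> /(ae_eq_integral_abs mu measurableT) h.
have := h (measurable_int _ fi); apply: (@filterS _ _ (ae_filter_ringOfSetsType mu)) => t /(_ I) [] /eqP.
by rewrite mulf_eq0 orbb => /eqP.
Qed.

End L2InnerProduct.

Section RieszFischer.
Local Open Scope quotient_scope.
Variable R : realType.
Local Notation mu := (@lebesgue_measure R : {measure set _ -> \bar R}).
Local Notation sqint := (LfunType mu (le1_2 R)).

(** The weights [2^n] make the differences summable, since
    [2 |b| <= 2^-n + 2^n b^2]. *)
Lemma weighted_square_cvg (a : nat -> R) :
  (\sum_(n <oo) (2 ^+ n * (a n.+1 - a n) ^+ 2)%:E < +oo)%E -> cvgn a.
Proof.
move=> afin; have tele n : a n = a 0%N + series (telescope a) n.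
  exact: eq_sum_telescope.
suff h : cvgn (series (telescope a)).
  have -> : a = (fun n => a 0%N + series (telescope a) n) by apply/funext.
  by apply: is_cvgD; [exact: is_cvg_cst|].
apply: normed_cvg; apply: nondecreasing_is_cvgn.
  apply/nondecreasing_seqP => n.
  by rewrite /= /series/= big_nat_recr//= lerDl.
set S := (\sum_(n <oo) _)%E in afin.
have S0 : (0 <= S)%E.
  by apply: nneseries_ge0 => n _ _; rewrite lee_fin mulr_ge0 ?sqr_ge0 ?exprn_ge0.
exists (2 + fine S) => _ [n _ <-]; rewrite /series/=.
apply: (@le_trans _ _ (\sum_(0 <= k < n) 2 ^- k +
    \sum_(0 <= k < n) 2 ^+ k * (a k.+1 - a k) ^+ 2)).
  rewrite -big_split/=; apply: ler_sum => k _; rewrite -[telescope a k]/(a k.+1 - a k).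
  have p0 : 0 < 2 ^+ k :> R by rewrite exprn_gt0.
  move: (a k.+1 - a k) => b; rewrite -[b ^+ 2]real_normK ?num_real//.
  have : 0 <= `|b| := normr_ge0 b; move: (`|b| : R) => c c0.
  rewrite -(ler_pM2l p0) mulrDr divff ?lt0r_neq0//.
  move: (2 ^+ k) p0 => p p0; have := sqr_ge0 (p * c - 1); nra.
apply: lerD.
  suff -> : \sum_(0 <= k < n) 2 ^- k = 2 - 2 * 2 ^- n :> R.
    by rewrite gerBl mulr_ge0// invr_ge0 exprn_ge0.
  elim: n => [|n IH]; first by rewrite big_geq// expr0 invr1; lra.
  by rewrite big_nat_recr//= IH exprS invfM; lra.
rewrite -lee_fin fineK ?ge0_fin_numE// -sumEFin.
by apply: nneseries_lim_ge => k _ _; rewrite lee_fin mulr_ge0 ?sqr_ge0 ?exprn_ge0.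
Qed.

Lemma limn_einf_le (v : nat -> \bar R) c : (forall k, (v k <= c)%E) ->
  (limn_einf v <= c)%E.
Proof.
move=> vc; apply: le_trans (limn_einf_sup _) _; rewrite limn_esup_lim.
apply: lime_le; first exact: is_cvg_esups.
by apply: nearW => n; apply: ub_ereal_sup => _ [k _ <-].
Qed.

Lemma limn_einf_ge0 (v : nat -> \bar R) : (forall k, (0 <= v k)%E) ->
  (0 <= limn_einf v)%E.
Proof.
move=> v0; rewrite limn_einf_lim; apply: lime_ge; first exact: is_cvg_einfs.
by apply: nearW => n; apply: le_ereal_inf_tmp => _ [k _ <-].
Qed.

Lemma measurable_sqr_diff (f g : R -> R) : measurable_fun setT f ->
  measurable_fun setT g -> measurable_fun setT (fun t => ((f t - g t) ^+ 2)%:E).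
Proof.
by move=> mf mg; apply/measurable_EFinP; apply: measurable_funX; exact: measurable_funB.
Qed.

Lemma norm0_pi (f : sqint) :
  (\int[mu]_t ((f : R -> R) t ^+ 2)%:E = (norm0 (@l2dot R) (\pi_(L2 R) f) ^+ 2)%:E)%E.
Proof.
rewrite (sqr_norm0 (l2dot_ip R)) l2dot_pi /Rintegral fineK.
  by apply: eq_integral => t _; rewrite expr2.
exact: integrable_fin_num (sqint_mul_integrable f f).
Qed.

(** Riesz-Fischer: the representatives converge almost everywhere by
    [weighted_square_cvg], and Fatou's lemma carries the norm estimates to the limit. *)
Lemma l2_fast_complete : fast_complete (@l2dot R).
Proof.
move=> e u e0 ue; have ip := l2dot_ip R.
pose f n : sqint := repr (u n).
pose D n : sqint := f n.+1 - f n.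
have uf n : u n = \pi_(L2 R) (f n) by rewrite reprK.
have mf n : measurable_fun setT (f n : R -> R) := sqint_measurable (f n).
have piB (g h : sqint) : \pi_(L2 R) g - \pi_(L2 R) h = \pi_(L2 R) (g - h).
  by apply: (addIr (\pi_(L2 R) h)); rewrite subrK -l2_piD subrK.
pose Hn n (t : R) := ((2 ^+ n * ((f n.+1 : R -> R) t - (f n : R -> R) t) ^+ 2)%:E)%E.
have Hn0 n t : (0 <= Hn n t)%E by rewrite lee_fin mulr_ge0 ?sqr_ge0 ?exprn_ge0.
pose H t := (\sum_(n <oo) Hn n t)%E.
have H0 t : (0 <= H t)%E by apply: nneseries_ge0 => n _ _; exact: Hn0.
have mHn n : measurable_fun setT (Hn n).
  apply/measurable_EFinP; apply: measurable_funM => //.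
  by apply: measurable_funX; apply: measurable_funB.
have Hfin : {ae mu, forall t, H t \is a fin_num}.
  have mH : measurable_fun setT H.
    exact: (@ge0_emeasurable_sum _ _ _ setT Hn xpredT).
  have iH : mu.-integrable setT H.
    apply/integrableP; split => //.
    have -> : (\int[mu]_t `|H t| = \int[mu]_t (\sum_(n <oo) Hn n t))%E.
      by apply: eq_integral => t _; rewrite gee0_abs//; exact: H0.
    rewrite integral_nneseries//.
    apply: (@le_lt_trans _ _ (2 * e ^+ 2)%:E); last by rewrite ltry.
    apply: le_trans (epsilon_trick0 xpredT _); last by rewrite mulr_ge0// sqr_ge0.
    apply: lee_nneseries => [n _ _|n _]; first by apply: integral_ge0 => t _; exact: Hn0.
    have := norm0_pi (D n); rewrite -piB -!uf => h.
    have -> : (\int[mu]_t Hn n t = (2 ^+ n)%:E * \int[mu]_t ((D n : R -> R) t ^+ 2)%:E)%E.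
      have mD : measurable_fun setT (fun t => ((D n : R -> R) t ^+ 2)%:E).
        by apply/measurable_EFinP; apply: measurable_funX; exact: sqint_measurable.
      have D0 t : setT t -> (0 <= ((D n : R -> R) t ^+ 2)%:E)%E by rewrite lee_fin sqr_ge0.
      have p0 : (0 <= (2 ^+ n)%:E :> \bar R)%E by rewrite lee_fin exprn_ge0.
      rewrite -(ge0_integralZl mu measurableT mD D0 p0).
      by apply: eq_integral => t _; rewrite -EFinM.
    rewrite h -EFinM lee_fin.
    have : norm0 (@l2dot R) (u n.+1 - u n) ^+ 2 <= (e * 2 ^- n) ^+ 2.
      by rewrite lerXn2r ?nnegrE ?norm0_ge0 ?mulr_ge0 ?(ltW e0) ?invr_ge0 ?exprn_ge0.
    have p0 : 0 < 2 ^+ n :> R by rewrite exprn_gt0.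
    move=> /(ler_wpM2l (ltW p0)) /le_trans; apply; rewrite le_eqVlt; apply/orP; left; apply/eqP.
    rewrite natrX (exprS 2 n); move: (2 ^+ n) p0 => p p0; field.
    by rewrite lt0r_neq0.
  have := integrable_ae measurableT iH.
  by apply: (@filterS _ _ (ae_filter_ringOfSetsType mu)) => t; apply.
pose F t := fine (limn_esup (fun n => ((f n : R -> R) t)%:E)).
have Fcvg : {ae mu, forall t, (f n : R -> R) t @[n --> \oo] --> F t}.
  move: Hfin; apply: (@filterS _ _ (ae_filter_ringOfSetsType mu)) => t Ht.
  have : cvgn (fun n => (f n : R -> R) t).
    apply: weighted_square_cvg; rewrite -ge0_fin_numE//; exact: H0.
  move=> /cvg_ex[l fl]; rewrite /F.
  have -> : limn_esup (fun n => ((f n : R -> R) t)%:E) = l%:E.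
    have : (fun n => ((f n : R -> R) t)%:E) @ \oo --> l%:E by apply: cvg_EFin => //; exact: nearW.
    by move=> /cvg_limn_einf_sup[].
  exact: fl.
have mF : measurable_fun setT F.
  apply: measurableT_comp => //; apply: measurable_fun_limn_esup => n.
  exact/measurable_EFinP.
have unk n k : norm0 (@l2dot R) (u (n + k)%N - u n) <= 2 * e * 2 ^- n.
  suff : norm0 (@l2dot R) (u (n + k)%N - u n) <= 2 * e * 2 ^- n - 2 * e * 2 ^- (n + k).
    by move/le_trans; apply; rewrite gerBl !mulr_ge0 ?(ltW e0)// invr_ge0 exprn_ge0.
  elim: k => [|k IH].
    by rewrite addn0 !subrr /norm0 (ip0l ip) sqrtr0.
  rewrite addnS; apply: le_trans (norm0B ip _ (u (n + k)%N) _) _.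
  apply: le_trans (lerD (ue _) IH) _.
  by rewrite [2 ^+ (n + k).+1]exprS invfM; lra.
have Fbound n : (\int[mu]_t ((F t - (f n : R -> R) t) ^+ 2)%:E <=
    ((2 * e * 2 ^- n) ^+ 2)%:E)%E.
  pose h k t := ((((f (n + k)%N : R -> R) t - (f n : R -> R) t) ^+ 2)%:E)%E.
  have mh k : measurable_fun setT (h k) by exact: measurable_sqr_diff.
  have h0 k t : (0 <= h k t)%E by rewrite lee_fin sqr_ge0.
  have hF : ae_eq mu setT (fun t => ((F t - (f n : R -> R) t) ^+ 2)%:E)
      (fun t => limn_einf (h ^~ t)).
    move: Fcvg; apply: (@filterS _ _ (ae_filter_ringOfSetsType mu)) => t Ft _.
    have : (h ^~ t) @ \oo --> ((F t - (f n : R -> R) t) ^+ 2)%:E.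
      apply: cvg_EFin; first exact: nearW.
      rewrite (_ : fine \o _ = (fun k => ((f (n + k)%N : R -> R) t - (f n : R -> R) t) ^+ 2)) //.
      under eq_fun do rewrite expr2.
      rewrite expr2.
      have hb : (f (n + k)%N : R -> R) t - (f n : R -> R) t @[k --> \oo] --> F t - (f n : R -> R) t.
        apply: cvgB; last exact: cvg_cst.
        by apply: cvg_comp Ft; exact: cvg_addnl.
      exact: cvgM.
    by move=> /cvg_limn_einf_sup[].
  rewrite (ge0_ae_eq_integral _ _ _ _ _ hF)//.
  - apply: le_trans (fatou mu measurableT mh (fun k t _ => h0 k t)) _.
    apply: limn_einf_le => k.
    rewrite -[X in (X <= _)%E]/(\int[mu]_t (((f (n + k)%N - f n : sqint) : R -> R) t ^+ 2)%:E)%E.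
    rewrite norm0_pi -piB -!uf lee_fin.
    by rewrite lerXn2r ?nnegrE ?norm0_ge0 ?unk// !mulr_ge0 ?(ltW e0)// invr_ge0 exprn_ge0.
  - exact: measurable_sqr_diff.
  - apply: (measurableT_comp (f := -%E)) => //.
    apply: measurable_fun_limn_esup => k.
    exact: measurableT_comp (mh k).
  - by move=> t _; rewrite lee_fin sqr_ge0.
  - by move=> t _; exact: limn_einf_ge0.
pose G t := F t - (f 0%N : R -> R) t.
have GL : G \in Lfun mu 2%:E.
  rewrite inE; apply/andP; split; rewrite inE/=; first exact: measurable_funB.
  rewrite /finite_norm unlock; apply: poweR_lty.
  have := Fbound 0%N; move=> /le_lt_trans - /(_ _ (ltry _)).
  congr (_ < _)%E; apply: eq_integral => t _.
  by rewrite /= powR_mulrn// real_normK ?num_real.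
pose g : sqint := Lfun_Sub (le1_2 R) GL.
exists (\pi_(L2 R) (g + f 0%N)) => n.
have := norm0_pi (g + f 0%N - f n).
rewrite -piB -uf => h.
rewrite -(@ler_pXn2r _ 2)// ?nnegrE ?norm0_ge0 ?mulr_ge0 ?(ltW e0) ?invr_ge0 ?exprn_ge0//.
rewrite -lee_fin -h; apply: le_trans (Fbound n).
rewrite le_eqVlt; apply/orP; left; apply/eqP; apply: eq_integral => t _.
rewrite -[((g + f 0%N - f n : sqint) : R -> R) t]/(F t - (f 0%N : R -> R) t + (f 0%N : R -> R) t - (f n : R -> R) t).
by rewrite subrK.
Qed.

End RieszFischer.

(** * Norms of test elements *)

Section Weights.
Variables (R : realType) (beta : R).
Hypothesis beta_ge0 : 0 <= beta.

Definition weight n : R := n`!%:R `^ (1 + beta).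

Lemma weight_gt0 n : 0 < weight n.
Proof. by rewrite powR_gt0// ltr0n fact_gt0. Qed.

Lemma weight_ge1 n : 1 <= weight n.
Proof.
rewrite -(powRr0 n`!%:R) ler_powR ?ler1n ?fact_gt0//.
by rewrite addr_ge0.
Qed.

(** [(m + k)! = C m! k!] with [C <= 2^(m + k)], and [1 - beta <= 1]. *)
Lemma weight_binomial m k :
  weight m * weight k * 'C(m + k, m)%:R ^+ 2 <= 2 ^+ (m + k) * weight (m + k).
Proof.
have C1 : 1 <= 'C(m + k, m)%:R :> R by rewrite ler1n bin_gt0 leq_addr.
have C0 : 0 <= 'C(m + k, m)%:R :> R by rewrite ler0n.
have C2 : 'C(m + k, m)%:R <= 2 ^+ (m + k) :> R.
  rewrite -natrX ler_nat -[2%N]/(1 + 1)%N expnDn (bigD1 (inord m)) //=.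
  by rewrite !exp1n !muln1 inordK ?leq_addr// ltnS leq_addr.
have -> : weight (m + k) = weight m * weight k * 'C(m + k, m)%:R `^ (1 + beta).
  rewrite /weight -!powRM ?ler0n ?mulr_ge0 ?ler0n//; congr (_ `^ _).
  by rewrite -!natrM -(bin_fact (leq_addr k m)) addKn mulnC.
rewrite [leRHS]mulrCA ler_wpM2l ?mulr_ge0 ?(ltW (weight_gt0 _))//.
set c := 'C(m + k, m)%:R in C0 C1 C2 *.
have -> : c ^+ 2 = c `^ (1 + beta) * c `^ (1 - beta).
  rewrite -powRD; first by rewrite -powR_mulrn//; congr (_ `^ _); ring.
  by rewrite (gt_eqF (lt_le_trans ltr01 C1)) implybT.
rewrite mulrC ler_wpM2r ?powR_ge0//; apply: le_trans C2.
by rewrite -[leRHS]powRr1// ler_powR// gerBl.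
Qed.

End Weights.
Arguments weight {R} beta n.

Section GappedInverse.
Variables (R : realType) (V : lmodType R).

(** What the analysis below retains of a white noise operator [A]: its inverse [B]
    is a symmetric strict contraction, and the test vectors are dense. *)
Record gapped_inverse (dot : V -> V -> R) (A : unbounded V) (B : V -> V)
    (kappa : R) : Prop := GappedInverse {
  gi_ip : inner_product dot;
  gi_inv : inverse_op A B;
  gi_lin : forall a x y, B (a *: x + y) = a *: B x + B y;
  gi_sym : forall x y, dot (B x) y = dot x (B y);
  gi_ge0 : 0 <= kappa;
  gi_lt1 : kappa < 1;
  gi_contr : forall x, dot (B x) (B x) <= kappa * dot x x;
  gi_dense : forall x (e : R), 0 < e ->
    exists2 y, testE A y & norm0 dot (x - y) <= e }.

End GappedInverse.

Lemma white_noise_gapped (R : realType) (A : unbounded (L2 R)) :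
  white_noise_op (@l2dot R) A ->
  exists B kappa, gapped_inverse (@l2dot R) A B kappa.
Proof.
move=> [[linA denA saA posA gap] [B invB _]].
have ip := l2dot_ip R.
have [c c1 cA] := spectrum_gap ip linA saA posA gap.
have c0 : 0 < c by rewrite (lt_trans _ c1).
have linB := inverse_linear linA invB.
have contrB := inverse_contraction ip c0 cA invB.
have k1 : c ^- 2 < 1 by rewrite invf_lt1 ?exprn_gt0// exprn_egt1.
have k0 : 0 <= c ^- 2 by rewrite invr_ge0 sqr_ge0.
exists B, (c ^- 2); split => //.
- exact: (inverse_sym saA).
- move=> x e e0; apply: (testE_dense ip invB linB) => //; last exact: l2_fast_complete.
  by move=> y; apply: le_trans (contrB y) _; rewrite ler_piMl ?(ip_ge0 ip)// ltW.
Qed.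

Section Chaos.
Variables (R : realType) (V : lmodType R) (dot : V -> V -> R).
Variables (A : unbounded V) (B : V -> V) (kappa beta : R).
Hypothesis gapB : gapped_inverse dot A B kappa.
Hypothesis beta_ge0 : 0 <= beta.
Local Notation C := (R[i]^o).
Local Notation X := (test dot A beta).
Local Notation N := (@test_norm R V dot A beta).
Local Notation cn := (chaos_norm2 dot A beta).
Local Notation dp := (dotp dot B).
Local Notation w := (weight beta).
Implicit Types f : seq V -> C.

Let ip := gi_ip gapB.
Let dp_ip p : inner_product (dp p) := dotp_ip ip (gi_inv gapB) (gi_lin gapB) p.

Lemma tnorm2_hs p n f : tnorm2 dot A p n f = hs (dp p) n f.
Proof. exact: (tnorm2E ip (gi_inv gapB) (gi_lin gapB)). Qed.

Lemma chaos_norm2E p f :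
  cn p f = (\sum_(0 <= n <oo) (w n)%:E * hs (dp p) n f)%E.
Proof. by apply: eq_eseriesr => n _; rewrite tnorm2_hs. Qed.

Lemma chaos_term_ge0 p f n : (0 <= (w n)%:E * hs (dp p) n f)%E.
Proof. by rewrite mule_ge0 ?hs_ge0// lee_fin ltW// weight_gt0. Qed.

Lemma chaos_term_le p f n : ((w n)%:E * hs (dp p) n f <= cn p f)%E.
Proof.
rewrite chaos_norm2E; apply: le_trans (nneseries_lim_ge n.+1 _); last first.
  by move=> k _ _; exact: chaos_term_ge0.
by rewrite big_nat_recr//= leeDr// sume_ge0// => k _; exact: chaos_term_ge0.
Qed.

Lemma chaos_norm2_le p f (c : R) : 0 <= c ->
  (forall n, ((w n)%:E * hs (dp p) n f <= (c * 2 ^- n)%:E)%E) ->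
  (cn p f <= (2 * c)%:E)%E.
Proof.
move=> c0 h; rewrite chaos_norm2E.
apply: le_trans (epsilon_trick0 xpredT _); last by rewrite mulr_ge0.
apply: lee_nneseries => [n _ _|n _]; first exact: chaos_term_ge0.
apply: le_trans (h n) _; rewrite lee_fin natrX (exprS 2 n) invfM.
by rewrite mulrACA divff// mul1r.
Qed.

Lemma dp_le p q x : (p <= q)%N -> dp q x x <= dp p x x.
Proof.
move=> /subnKC <-; apply: le_trans (dotp_le (gi_ge0 gapB) (gi_contr gapB) _ _ _) _.
by rewrite ler_piMl ?(ip_ge0 (dp_ip p))// exprn_ile1 ?(gi_ge0 gapB)// ltW ?(gi_lt1 gapB).
Qed.

Lemma hs_mono p q n f : multilinear f -> (p <= q)%N ->
  (hs (dp p) n f <= hs (dp q) n f)%E.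
Proof.
move=> fm pq; have := @hs_compare _ _ (dp p) (dp q) 1 n f (dp_ip p) (dp_ip q).
rewrite expr1n mul1e; apply => // x; rewrite mul1r; exact: dp_le.
Qed.

Lemma cn_mono p q f : multilinear f -> (p <= q)%N -> (cn p f <= cn q f)%E.
Proof.
move=> fm pq; rewrite !chaos_norm2E; apply: lee_nneseries => [n _ _|n _].
  exact: chaos_term_ge0.
by apply: lee_wpmul2l; [rewrite lee_fin ltW ?weight_gt0|exact: hs_mono].
Qed.

Lemma test_multilinear (f : X) : multilinear f.
Proof. by have /asboolP[] := testP f. Qed.

Lemma test_symmetric (f : X) : symmetric_form f.
Proof. by have /asboolP[] := testP f. Qed.

Lemma N_mono p q (f : X) : (p <= q)%N -> N p f <= N q f.
Proof.
move=> pq; have := cn_mono (test_multilinear f) pq.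
rewrite !chaos_normK lee_fin.
by rewrite ler_pXn2r ?nnegrE ?test_norm_ge0.
Qed.

(** Raising the order of the norm by [gain] multiplies the [n]-th term of the chaos
    expansion by at least [16 ^ n]; this pays for the exponential factors [2 ^ n] of
    [weight_binomial] and for geometric summability in both indices. *)
Lemma ex_gain : exists r, kappa ^+ r <= 16^-1.
Proof.
have : (fun n => geometric (1:R) kappa n) @ \oo --> (0 : R).
  by apply: cvg_geometric; rewrite ger0_norm ?(gi_ge0 gapB)// (gi_lt1 gapB).
have h0 : 0 < 16^-1 :> R by rewrite invr_gt0.
move=> /cvgr_le /(_ _ h0) [r _ h]; exists r.
by have := h r (leqnn r); rewrite /geometric /= mul1r.
Qed.

Definition gain := projT1 (cid ex_gain).

Lemma gainP : kappa ^+ gain <= 16^-1.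
Proof. exact: projT2 (cid ex_gain). Qed.

Lemma hs_gain p n f : multilinear f ->
  (hs (dp p) n f <= (16 ^- n)%:E * hs (dp (p + gain)) n f)%E.
Proof.
move=> fm; apply: le_trans
  (hs_dotp_le ip (gi_inv gapB) (gi_lin gapB) (gi_ge0 gapB) (gi_contr gapB) p gain n fm) _.
apply: lee_wpmul2r; first exact: hs_ge0.
rewrite lee_fin exprM -exprVn; apply: lerXn2r; rewrite ?nnegrE ?exprn_ge0 ?(gi_ge0 gapB)//.
exact: gainP.
Qed.

Lemma test_term_le p n (f : X) :
  ((w n)%:E * hs (dp p) n f <= (16 ^- n * N (p + gain) f ^+ 2)%:E)%E.
Proof.
apply: (@le_trans _ _ ((w n)%:E * ((16 ^- n)%:E * hs (dp (p + gain)) n f))%E).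
  apply: lee_wpmul2l; first by rewrite lee_fin ltW ?weight_gt0.
  exact: hs_gain (test_multilinear f).
rewrite muleCA EFinM -chaos_normK; apply: lee_wpmul2l.
  by rewrite lee_fin invr_ge0 exprn_ge0.
exact: chaos_term_le.
Qed.

(** Cauchy-Schwarz for the sum over [s], and then Bessel's inequality in all slots
    at once: those filled from [F] and the remaining [k] ones. *)
Lemma hs_contract q k (F : seq (R * seq V)) (c : seq V -> R[i]) f :
  multilinear f -> (forall cx, cx \in F -> bessel (dp q) cx.1 cx.2) ->
  (hs (dp q) k (fun t => \sum_(s <- words [seq cx.2 | cx <- F]) c s * f (s ++ t))%R
   <= ((\sum_(s <- words [seq cx.2 | cx <- F]) normc (c s) ^+ 2) *
       \prod_(cx <- F) cx.1)%:E * hs (dp q) (size F + k) f)%E.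
Proof.
move=> fm bF; apply: hs_le => zs ozs; set W := words _.
set S := \sum_(s <- W) _.
have S0 : 0 <= S by apply: sumr_ge0 => s _; exact: sqr_ge0.
have b1 : bessel (dp q) 1 zs.
  by apply: (@bessel_ortho _ _ (dp q) (dp q)) => // x; rewrite mul1r.
have := @ssq_le_hs _ _ (dp q) (F ++ nseq k (1, zs)) f (dp_ip q).
rewrite map_cat map_nseq size_cat size_nseq big_cat/= prod_nseq expr1n mulr1.
move=> /(_ _ fm) h; rewrite EFinM -muleA.
apply: (@le_trans _ _ (S%:E *
    (ssq ([seq cx.2 | cx <- F] ++ nseq k zs) f)%:E)%E); last first.
  apply: lee_wpmul2l; first by rewrite lee_fin.
  apply: h => cx; rewrite mem_cat => /orP[|]; first exact: bF.
  by rewrite mem_nseq => /andP[_ /eqP ->].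
rewrite -EFinM lee_fin /ssq sum_words_cat -/W [X in S * X]exchange_big/= mulr_sumr.
by apply: ler_sum => t _; exact: normc_cauchy_schwarz.
Qed.

(** The annihilation operator of the list [s], divided by [(size s)!]: on kernels it
    is the partial evaluation at [s] with a binomial factor. *)
Definition annih (s : seq V) f : seq V -> C :=
  fun t => 'C(size s + size t, size s)%:R * f (s ++ t).

Lemma annih_multilinear s f : multilinear f -> multilinear (annih s f).
Proof.
move=> fm t u a x y; rewrite /annih !catA fm !size_cat /=; ring.
Qed.

Lemma annih_symmetric s f : symmetric_form f -> symmetric_form (annih s f).
Proof.
move=> fs t u tu; rewrite /annih (perm_size tu); congr (_ * _).
by apply: fs; rewrite perm_cat2l.
Qed.

(** The factor [weight beta (size F)] on the left is what makes the double sum over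
    the orders of [F] and of the remaining kernel an expression in the weights
    [weight beta (size F + k)], by [weight_binomial]; the gain in regularity then
    makes both sums geometric. *)
Lemma chaos_contract q (F : seq (R * seq V)) (c : seq V -> R[i]) (f : X) :
  (forall cx, cx \in F -> bessel (dp q) cx.1 cx.2) ->
  ((w (size F))%:E * cn q (fun t => \sum_(s <- words [seq cx.2 | cx <- F]) c s * annih s f t)%R
   <= (2 * (8 ^- size F * ((\sum_(s <- words [seq cx.2 | cx <- F]) normc (c s) ^+ 2) *
       \prod_(cx <- F) cx.1) * N (q + gain) f ^+ 2))%:E)%E.
Proof.
move=> bF; set W := words _; set S := \sum_(s <- W) _; set P := \prod_(_ <- _) _.
set m := size F.
have S0 : 0 <= S by apply: sumr_ge0 => s _; exact: sqr_ge0.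
have P0 : 0 <= P by rewrite /P big_seq prodr_ge0// => cx /bF[].
have wm := weight_gt0 beta m.
set K := 8 ^- m * (S * P) * N (q + gain) f ^+ 2.
have K0 : 0 <= K by rewrite !mulr_ge0 ?invr_ge0 ?exprn_ge0 ?test_norm_ge0.
rewrite muleC -lee_pdivlMr// -EFinM -mulrA.
apply: chaos_norm2_le; first by rewrite divr_ge0// ltW.
move=> k.
rewrite (@eq_hs _ _ _ _ _ (fun t => \sum_(s <- W) ('C(m + k, m)%:R * c s) * f (s ++ t))); last first.
  move=> t tk; apply: eq_big_seq => s /size_words; rewrite size_map -/m => sm.
  by rewrite /annih sm tk mulrCA mulrA.
have fm := test_multilinear f.
have h := hs_contract k (fun s => 'C(m + k, m)%:R * c s) fm bF.
apply: (le_trans (lee_wpmul2l _ h)); first by rewrite lee_fin ltW ?weight_gt0.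
rewrite -/W -/m -/P.
have -> : \sum_(s <- W) normc ('C(m + k, m)%:R * c s) ^+ 2 = 'C(m + k, m)%:R ^+ 2 * S.
  rewrite /S mulr_sumr; apply: eq_bigr => s _; rewrite normcM exprMn; congr (_ ^+ 2 * _).
  exact: normc_nat.
have t := test_term_le q (m + k) f.
apply: (@le_trans _ _ ((2 ^+ (m + k) * (w m)^-1 * (S * P))%:E *
   ((w (m + k))%:E * hs (dp q) (m + k) f))%E).
  rewrite !muleA -!EFinM; apply: lee_wpmul2r; first exact: hs_ge0.
  rewrite lee_fin -(ler_pM2l wm).
  have -> : w m * (w k * ('C(m + k, m)%:R ^+ 2 * S * P)) =
    (w m * w k * 'C(m + k, m)%:R ^+ 2) * (S * P) by ring.
  have -> : w m * (2 ^+ (m + k) / w m * (S * P) * w (m + k)) =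
    (2 ^+ (m + k) * w (m + k)) * (S * P) by field; rewrite gt_eqF.
  by rewrite ler_wpM2r ?mulr_ge0// weight_binomial.
apply: le_trans (lee_wpmul2l _ t) _.
  by rewrite lee_fin !mulr_ge0 ?invr_ge0 ?exprn_ge0 ?(ltW wm).
rewrite -EFinM lee_fin /K.
have -> : 16 ^- (m + k) = 2 ^- (m + k) * 8 ^- m * 8 ^- k :> R.
  by rewrite -mulrA -invfM -exprD -invfM -exprMn -natrM.
have -> : 2 ^+ (m + k) / w m * (S * P) *
   (2 ^- (m + k) * 8 ^- m * 8 ^- k * N (q + gain) f ^+ 2) =
   8 ^- m * (S * P) * N (q + gain) f ^+ 2 / w m * 8 ^- k.
  field; rewrite !gt_eqF ?exprn_gt0//.
rewrite ler_wpM2l ?divr_ge0 ?(ltW wm)//.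
by rewrite lef_pV2 ?posrE ?exprn_gt0// lerXn2r ?nnegrE// ler_nat.
Qed.

Lemma words_singletons (s : seq V) : words [seq [:: x] | x <- s] = [:: s].
Proof. by elim: s => //= x s ->. Qed.

Lemma annih_is_test s (f : X) : annih s f \in is_test dot A beta.
Proof.
apply/asboolP; split.
- exact: annih_multilinear (test_multilinear f).
- exact: annih_symmetric (test_symmetric f).
move=> q.
have := @chaos_contract q [seq (dp q x x, [:: x]) | x <- s] (fun=> 1) f.
rewrite -map_comp size_map (eq_map (g := fun x => [:: x]))// words_singletons.
rewrite (_ : (fun t => _) = annih s f); last by apply/funext => t; rewrite big_seq1 mul1r.
move=> /(_ _)/le_lt_trans h.
have {}h : ((w (size s))%:E * cn q (annih s f) < +oo)%E.
  apply: h; last exact: ltry.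
  by move=> _ /mapP[x _ ->]; exact: (bessel1 (dp_ip q)).
apply: le_lt_trans h; rewrite -[leLHS]mul1e; apply: lee_wpmul2r.
  exact: chaos_norm2_ge0.
by rewrite lee_fin weight_ge1.
Qed.

Definition annihT s (f : X) : X := Test (annih_is_test s f).

End Chaos.

Lemma complex_gt0 (R : realType) (e : R[i]) : 0 < e ->
  exists2 e' : R, 0 < e' & e = e'%:C%C.
Proof.
by case: e => a b /andP[/eqP /= -> a0]; exists a.
Qed.

(** * Continuous functionals and operators *)

Section Functionals.
Variables (R : realType) (V : lmodType R) (dot : V -> V -> R).
Variables (A : unbounded V) (B : V -> V) (kappa beta : R).
Hypothesis gapB : gapped_inverse dot A B kappa.
Local Notation C := (R[i]^o).
Local Notation X := (test dot A beta).
Local Notation N := (@test_norm R V dot A beta).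
Local Notation dual := (dual dot A beta).
Local Notation lop := (lop dot A beta).

Lemma chaos_sum (I : Type) (r : seq I) (F : I -> X) t :
  (\sum_(i <- r) F i : X) t = \sum_(i <- r) F i t.
Proof.
elim: r => [|i r IH]; first by rewrite !big_nil.
by rewrite !big_cons -IH.
Qed.

Lemma chaosZ a (f : X) t : (a *: f) t = a * f t.
Proof. by []. Qed.

Lemma dual_linear (phi : dual) a f g : phi (a *: f + g) = a * phi f + phi g.
Proof. by have /asboolP[h _] := dualP phi; exact: h. Qed.

Lemma dual0 (phi : dual) : phi 0 = 0.
Proof.
by have := dual_linear phi (-1) 0 0; rewrite scaler0 addr0 mulN1r addNr.
Qed.

Lemma dualZ (phi : dual) a f : phi (a *: f) = a * phi f.
Proof. by rewrite -[a *: f]addr0 dual_linear dual0 addr0. Qed.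

Lemma dual_sum (phi : dual) (I : Type) (r : seq I) (F : I -> X) :
  phi (\sum_(i <- r) F i) = \sum_(i <- r) phi (F i).
Proof.
elim: r => [|i r IH]; first by rewrite !big_nil dual0.
by rewrite !big_cons -[F i]scale1r dual_linear mul1r IH scale1r.
Qed.

Lemma near_test_norm (f : X) p (e : R) : 0 < e -> \forall g \near f, N p (f - g) < e.
Proof.
have /(@cvg_testP R V dot A beta _ _ (nbhs_filter f) id f) h : id @ nbhs f --> f by apply: cvg_id.
by move=> e0; exact: h.
Qed.

Lemma continuous_functional (Psi : X -> C) q K :
  (forall a f g, Psi (a *: f + g) = a * Psi f + Psi g) ->
  (forall f, normc (Psi f) <= K * N q f) -> Psi \in @is_dual R V dot A beta.
Proof.
move=> lin bnd; apply/asboolP; split=> // f.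
have PsiB g h : Psi (g - h) = Psi g - Psi h.
  by rewrite addrC -scaleN1r lin mulN1r addrC.
apply/(@cvgrPdist_lt _ _ _ _ (nbhs_filter f)) => e e0.
have K0 : 0 < `|K| + 1 by rewrite ltr_wpDl.
have [e' e'0 ->] := complex_gt0 e0.
have := @near_test_norm f q (e' / (`|K| + 1)) (divr_gt0 e'0 K0).
apply: filterS => g; rewrite ltr_pdivlMr// => h.
rewrite -PsiB [`|_|]/(normc _)%:C%C ltcR.
apply: le_lt_trans (bnd _) _; apply: le_lt_trans h.
rewrite mulrC ler_wpM2l ?test_norm_ge0// (le_trans (ler_norm _))// lerDl//.
Qed.

Lemma dual_bound (phi : dual) : exists q, exists2 K, 0 <= K &
  forall f, normc (phi f) <= K * N q f.
Proof.
have /asboolP[_ /(_ 0) cphi] := dualP phi.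
have : \forall g \near (0 : X), `|phi 0 - phi g| < 1.
  exact: (@cvgrPdist_lt _ _ _ _ (nbhs_filter (0 : X)) phi (phi 0)).1 cphi 1 ltr01.
move=> /nbhsP[E [[q e] /= e0 qE] sE].
exists q, (2 / e); first by rewrite divr_ge0// ltW.
have small g : N q g < e -> normc (phi g) < 1.
  move=> ge; have : `|phi 0 - phi g| < 1.
    apply: sE; apply/xsectionP/qE => p pq /=; rewrite sub0r.
    apply: le_lt_trans (test_normN _ _) _.
    exact: le_lt_trans (N_mono gapB _ pq) ge.
  by rewrite dual0 sub0r normrN [`|_|]/(normc _)%:C%C -[1]/(1%:C%C) ltcR.
move=> f; apply/ler_addgt0Pr => eta eta0.
pose c := N q f + eta * e / 2.
have Nf := test_norm_ge0 q f.
have ee : 0 < eta * e / 2 by rewrite !mulr_gt0.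
have c0 : 0 < c by rewrite ltr_wpDl.
have t0 : 0 < e / (2 * c) by rewrite divr_gt0// mulr_gt0.
have := small ((e / (2 * c))%:C%C *: f).
rewrite dualZ normcM normc_real gtr0_norm// => h.
have {}h : e / (2 * c) * normc (phi f) < 1.
  apply: h; apply: le_lt_trans (test_normZ _ _ _) _.
  rewrite normc_real gtr0_norm//.
  rewrite mulrAC ltr_pdivrMr ?mulr_gt0// ltr_pM2l//.
  by rewrite /c; lra.
move: h; rewrite mulrAC ltr_pdivrMr ?mulr_gt0// mul1r mulrC -ltr_pdivlMr// => /ltW /le_trans; apply.
rewrite /c le_eqVlt; apply/orP; left; apply/eqP; field.
by rewrite gt_eqF.
Qed.

Lemma lop_of_bound (T : X -> X) :
  (forall a f g, T (a *: f + g) = a *: T f + T g) ->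
  (forall p, exists q K, forall f, N p (T f) <= K * N q f) ->
  T \in @is_lop R V dot A beta.
Proof.
move=> lin bnd; apply/asboolP; split=> //; apply/test_continuousP => f p e e0.
have TB g h : T (g - h) = T g - T h.
  by rewrite addrC -scaleN1r lin scaleN1r addrC.
have [q [K bq]] := bnd p.
have K0 : 0 < `|K| + 1 by rewrite ltr_wpDl.
have := @near_test_norm f q (e / (`|K| + 1)) (divr_gt0 e0 K0).
apply: filterS => g; rewrite ltr_pdivlMr// => h.
rewrite -TB; apply: le_lt_trans (bq _) _; apply: le_lt_trans h.
rewrite mulrC ler_wpM2l ?test_norm_ge0// (le_trans (ler_norm _))// lerDl//.
Qed.

Lemma lop_linear (T : lop) a f g : T (a *: f + g) = a *: T f + T g.
Proof. by have /asboolP[h _] := lopP T; exact: h. Qed.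

Lemma comp_is_dual (psi : dual) (T : lop) : (psi : X -> C) \o T \in @is_dual R V dot A beta.
Proof.
have /asboolP[_ Tc] := lopP T; have /asboolP[_ Pc] := dualP psi.
apply/asboolP; split; first by move=> a f g /=; rewrite lop_linear dual_linear.
by move=> f; apply: continuous_comp; [exact: Tc|exact: Pc].
Qed.

Definition dual_comp (psi : dual) (T : lop) : dual := Dual (comp_is_dual psi T).

Lemma near_dual (phi : dual) (M : set X) (e : R) :
  test_bounded M -> 0 < e ->
  nbhs phi [set psi : dual | forall f, M f -> normc (phi f - psi f) < e].
Proof.
move=> bM e0.
have FF : Filter ((@dual_fun _ _ _ _ _ : dual -> X -> C) @ phi)
  by apply: fmap_filter; exact: nbhs_filter.
have h := (fam_cvgP _ _ FF).1 (@initial_continuous dual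
  {family (test_bounded (beta:=beta)), X -> C} (@dual_fun _ _ _ _ _) phi) M bM.
have : nbhs (phi : {uniform` M -> C}) [set h : X -> C | forall f, M f -> normc (phi f - h f) < e].
  apply/uniform_nbhs; exists [set xy : C * C | normc (xy.1 - xy.2) < e]; split => //.
  rewrite -entourage_ballE; exists e%:C%C; first by rewrite /= ltcR.
  by move=> [x y] /=; rewrite /ball /= [`|_|]/(normc _)%:C%C ltcR.
by move=> /h.
Qed.


Lemma near_lop (T : lop) (M : set X) p (e : R) :
  test_bounded M -> 0 < e ->
  nbhs T [set U : lop | forall f, M f -> N p (T f - U f) < e].
Proof.
move=> bM e0.
have FF : Filter ((@lop_fun _ _ _ _ _ : lop -> X -> X) @ T)
  by apply: fmap_filter; exact: nbhs_filter.
have h := (fam_cvgP _ _ FF).1 (@initial_continuous lop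
  {family (test_bounded (beta:=beta)), X -> X} (@lop_fun _ _ _ _ _) T) M bM.
have : nbhs (T : {uniform` M -> X}) [set h : X -> X | forall f, M f -> N p (T f - h f) < e].
  apply/uniform_nbhs; exists [set xy : X * X | N p (xy.1 - xy.2) < e]; split => //.
  by exists (p, e) => //= xy; apply.
by move=> /h.
Qed.

Lemma continuous_to_dual (T : topologicalType) (G : T -> dual) :
  (forall t (M : set X) (e : R), test_bounded M -> 0 < e ->
    nbhs t [set u | forall f, M f -> normc (G t f - G u f) < e]) -> continuous G.
Proof.
move=> h; apply: (@continuous_comp_initial dual T {family (test_bounded (beta:=beta)), X -> C}
  (@dual_fun _ _ _ _ _)) => t.
apply/(@fam_cvgP X C) => M bM P /uniform_nbhs[E [+ EP]].
rewrite -entourage_ballE => -[e /= /complex_gt0[e' e'0 ->] eE].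
have := h t M e' bM e'0; apply: filterS => u hu; apply: EP => f Mf; apply: eE.
by rewrite /ball /= [`|_|]/(normc _)%:C%C ltcR; exact: hu.
Qed.

Lemma continuous_to_lop (T : topologicalType) (G : T -> lop) :
  (forall t (M : set X) p (e : R), test_bounded M -> 0 < e ->
    nbhs t [set u | forall f, M f -> N p (G t f - G u f) < e]) -> continuous G.
Proof.
move=> h; apply: (@continuous_comp_initial lop T {family (test_bounded (beta:=beta)), X -> X}
  (@lop_fun _ _ _ _ _)) => t.
apply/(@fam_cvgP X X) => M bM P /uniform_nbhs[E [[[q e] /= e0 qE] EP]].
have := h t M q e bM e0; apply: filterS => u hu; apply: EP => f Mf; apply: qE => p pq /=.
by apply: le_lt_trans (hu f Mf); exact: (N_mono gapB).
Qed.

End Functionals.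

(** * The convolution operator *)

(** Take for [c] the normalized conjugate of [a]. *)
Lemma sum_normc_dual (R : realType) (I : Type) (r : seq I) (a : I -> R[i]) (K : R) :
  (forall c : I -> R[i], \sum_(i <- r) normc (c i) ^+ 2 <= 1 ->
    normc (\sum_(i <- r) c i * a i) <= K) ->
  \sum_(i <- r) normc (a i) ^+ 2 <= K ^+ 2.
Proof.
move=> h; set S := \sum_(i <- r) _.
have S0 : 0 <= S by apply: sumr_ge0 => i _; exact: sqr_ge0.
have [->|Sn] := eqVneq S 0; first exact: sqr_ge0.
have sp : 0 < Num.sqrt S by rewrite sqrtr_gt0 lt_def Sn.
pose c i := ((Num.sqrt S)^-1)%:C%C * conjc (a i).
have nc i : normc (c i) ^+ 2 = S^-1 * normc (a i) ^+ 2.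
  rewrite /c normcM exprMn normc_real ger0_norm ?invr_ge0 ?ltW// exprVn sqr_sqrtr//.
  by congr (_ * _); rewrite !sqr_normc; case: (a i) => x y /=; rewrite sqrrN.
have := h c; rewrite (eq_bigr _ (fun i _ => nc i)) -mulr_sumr mulVf// => /(_ (lexx _)).
have -> : \sum_(i <- r) c i * a i = (Num.sqrt S)%:C%C.
  rewrite /c (eq_bigr (fun i => ((Num.sqrt S)^-1)%:C%C * (normc (a i) ^+ 2)%:C%C)).
    rewrite -mulr_sumr -(raddf_sum (real_complex R)) -/S -rmorphM.
    by rewrite -[X in _ * X](sqr_sqrtr S0) expr2 mulKf// gt_eqF.
  move=> i _; rewrite -mulrA sqr_normc; congr (_ * _).
  by case: (a i) => x y /=; apply/eqP; rewrite eq_complex /=; apply/andP; split; apply/eqP; ring.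
rewrite normc_real (gtr0_norm sp) => sK.
rewrite -(sqr_sqrtr S0) lerXn2r ?nnegrE ?(ltW sp)//.
exact: le_trans (ltW sp) sK.
Qed.

Section Convolution.
Variables (R : realType) (V : lmodType R) (dot : V -> V -> R).
Variables (A : unbounded V) (B : V -> V) (kappa beta : R).
Hypothesis gapB : gapped_inverse dot A B kappa.
Hypothesis beta_ge0 : 0 <= beta.
Local Notation C := (R[i]^o).
Local Notation X := (test dot A beta).
Local Notation N := (@test_norm R V dot A beta).
Local Notation cn := (chaos_norm2 dot A beta).
Local Notation dp := (dotp dot B).
Local Notation w := (weight beta).
Local Notation dual := (dual dot A beta).
Local Notation lop := (lop dot A beta).
Local Notation D := (annihT gapB beta_ge0).
Local Notation gain := (gain gapB).
Implicit Types (phi : dual) (f : X).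

Let dp_ip p : inner_product (dp p) := dotp_ip (gi_ip gapB) (gi_inv gapB) (gi_lin gapB) p.

Lemma annihT_linear s a f g : D s (a *: f + g) = a *: D s f + D s g.
Proof.
apply/val_inj/funext => t; rewrite /= -[RHS]/(a * annih s f t + annih s g t) /annih.
rewrite -[X in _ * X = _]/(a * f (s ++ t) + g (s ++ t)).
by rewrite mulrDr mulrCA.
Qed.

Lemma annihT_multilinear s u (a : R) x y f :
  D (s ++ (a *: x + y) :: u) f = a%:C%C *: D (s ++ x :: u) f + D (s ++ y :: u) f.
Proof.
apply/val_inj/funext => t /=.
rewrite -[RHS]/(a%:C%C * annih (s ++ x :: u) f t + annih (s ++ y :: u) f t).
rewrite /annih -!catA !cat_cons (test_multilinear f) !size_cat/=; ring.
Qed.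

Lemma annihT_perm s s' f : perm_eq s s' -> D s f = D s' f.
Proof.
move=> ss; apply/val_inj/funext => t /=; rewrite /annih (perm_size ss).
by congr (_ * _); apply: (test_symmetric f); rewrite perm_cat2r.
Qed.

(** The [p]-th norm of the convolution of [f] by a functional is a sum of squares of
    its values on [annihT s f], over words [s] in an orthonormal family. By duality
    such a sum is controlled by the values on single test elements, the probes. They
    are bounded in all norms, uniformly on bounded sets of [f], which turns bounds
    of the functional on bounded sets into bounds of the operator. *)
Definition probe m zs (c : seq V -> R[i]) f : X :=
  (Num.sqrt (4 ^+ m * w m))%:C%C *: \sum_(s <- words (nseq m zs)) c s *: D s f.

(** The hypothesis [p <= q] makes [zs] a Bessel family with bound 1 for the q-th inner
   product. *)
Lemma probe_bound p q m zs c f : (p <= q)%N -> orthoseq (dp p) zs ->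
  \sum_(s <- words (nseq m zs)) normc (c s) ^+ 2 <= 1 ->
  N q (probe m zs c f) <= 2 * N (q + gain) f.
Proof.
move=> pq ozs c1; have wm := weight_gt0 beta m.
have N0 := test_norm_ge0 q; have N0' := test_norm_ge0 (q + gain) f.
pose h := \sum_(s <- words (nseq m zs)) c s *: D s f.
have k0 : 0 <= Num.sqrt (4 ^+ m * w m) by exact: sqrtr_ge0.
have h1 : N q (probe m zs c f) <= Num.sqrt (4 ^+ m * w m) * N q h.
  by apply: le_trans (test_normZ _ _ _) _; rewrite normc_real ger0_norm.
have := @chaos_contract _ _ _ _ _ _ _ gapB beta_ge0 q (nseq m (1, zs)) c f.
rewrite map_nseq size_nseq prod_nseq expr1n mulr1.
have -> : (fun t => \sum_(s <- words (nseq m zs)) c s * annih s f t) = (h : seq V -> C).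
  by apply/funext => t; rewrite /h chaos_sum.
rewrite chaos_normK -EFinM lee_fin => h2.
have {}h2 : w m * N q h ^+ 2 <= 2 * (8 ^- m * N (q + gain) f ^+ 2).
  apply: le_trans (h2 _) _.
    move=> cx; rewrite mem_nseq => /andP[_ /eqP ->] /=.
    apply: (bessel_ortho (dp_ip p) (dp_ip q)) => // x; rewrite mul1r.
    exact: (dp_le gapB).
  by rewrite ler_pM2l// ler_wpM2r ?sqr_ge0// ler_piMr// invr_ge0 exprn_ge0.
apply: le_trans h1 _; rewrite -(@ler_pXn2r _ 2)// ?nnegrE ?mulr_ge0 ?test_norm_ge0//.
rewrite !exprMn sqr_sqrtr ?mulr_ge0 ?exprn_ge0 ?(ltW wm)// -mulrA.
apply: (le_trans (ler_wpM2l _ h2)); first by rewrite exprn_ge0.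
have h4 : 4 ^+ m * 8 ^- m <= 1 :> R.
  by rewrite ler_pdivrMr ?exprn_gt0// mul1r lerXn2r ?nnegrE// ler_nat.
have -> : 4 ^+ m * (2 * (8 ^- m * N (q + gain) f ^+ 2)) =
    4 ^+ m * 8 ^- m * (2 * N (q + gain) f ^+ 2) by ring.
have n2 := sqr_ge0 (N (q + gain) f).
by apply: le_trans (ler_wpM2r _ h4) _; [exact: mulr_ge0|lra].
Qed.

Lemma probe_functional phi m zs c f :
  phi (probe m zs c f) =
  (Num.sqrt (4 ^+ m * w m))%:C%C * \sum_(s <- words (nseq m zs)) c s * phi (D s f).
Proof.
by rewrite dualZ dual_sum; congr (_ * _); apply: eq_bigr => s _; rewrite dualZ.
Qed.

Definition conv_fun phi f : seq V -> C := fun s => phi (D s f).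

Lemma conv_fun_norm phi f p (e : R) :
  (forall m zs c, orthoseq (dp p) zs ->
    \sum_(s <- words (nseq m zs)) normc (c s) ^+ 2 <= 1 ->
    normc (phi (probe m zs c f)) <= e) ->
  (cn p (conv_fun phi f) <= (2 * e ^+ 2)%:E)%E.
Proof.
move=> h; apply: (chaos_norm2_le gapB) => [|m]; first exact: sqr_ge0.
have wm := weight_gt0 beta m.
have k0 : 0 < Num.sqrt (4 ^+ m * w m) by rewrite sqrtr_gt0 mulr_gt0// exprn_gt0.
rewrite muleC -lee_pdivlMr// -EFinM; apply: hs_le => zs ozs; rewrite lee_fin /ssq.
have : \sum_(s <- words (nseq m zs)) normc (conv_fun phi f s) ^+ 2 <=
    (e / Num.sqrt (4 ^+ m * w m)) ^+ 2.
  apply: sum_normc_dual => c c1; rewrite ler_pdivlMr//.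
  have := h m zs c ozs c1; rewrite probe_functional normcM normc_real gtr0_norm//.
  by rewrite mulrC.
move=> /le_trans; apply.
rewrite exprMn exprVn sqr_sqrtr ?mulr_ge0 ?exprn_ge0 ?(ltW wm)// invfM mulrA.
rewrite ler_wpM2r ?invr_ge0 ?(ltW wm)// ler_wpM2l ?sqr_ge0//.
by rewrite lef_pV2 ?posrE ?exprn_gt0// lerXn2r ?nnegrE// ler_nat.
Qed.

Lemma conv_fun_bound phi : forall p, exists q K, forall f,
  (cn p (conv_fun phi f) <= ((K * N q f) ^+ 2)%:E)%E.
Proof.
have [q [K K0 bphi]] := dual_bound gapB phi.
move=> p; exists (maxn p q + gain)%N, (4 * K) => f.
have N0 := test_norm_ge0 (maxn p q + gain) f.
apply: (le_trans (@conv_fun_norm phi f p (2 * K * N (maxn p q + gain) f) _)).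
  move=> m zs c ozs c1; apply: le_trans (bphi _) _.
  rewrite (mulrC 2) -mulrA ler_wpM2l//.
  apply: le_trans (N_mono gapB _ (leq_maxr p q)) _.
  by apply: probe_bound c1; [exact: leq_maxl|exact: ozs].
rewrite lee_fin; move: (N _ _) N0 => x x0; have := sqr_ge0 (K * x); nra.
Qed.

Lemma conv_is_test phi f : conv_fun phi f \in @is_test R V dot A beta.
Proof.
apply/asboolP; split.
- by move=> s t a x y; rewrite /conv_fun annihT_multilinear dual_linear.
- by move=> s t st; rewrite /conv_fun (annihT_perm f st).
- by move=> p; have [q [K h]] := conv_fun_bound phi p; apply: le_lt_trans (h f) (ltry _).
Qed.

Definition convT phi f : X := Test (conv_is_test phi f).

Lemma convT_is_lop phi : convT phi \in @is_lop R V dot A beta.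
Proof.
apply: lop_of_bound.
  move=> a f g; apply/val_inj/funext => s /=.
  by rewrite /conv_fun annihT_linear dual_linear.
move=> p; have [q [K h]] := conv_fun_bound phi p; exists q, `|K| => f.
have N0 := test_norm_ge0 q f.
have := h f; rewrite -[conv_fun phi f]/(chaos (convT phi f)) chaos_normK lee_fin.
move=> h'; rewrite -(@ler_pXn2r _ 2)// ?nnegrE ?mulr_ge0 ?test_norm_ge0//.
by apply: le_trans h' _; rewrite !exprMn real_normK ?num_real.
Qed.

(** It is shown below to be the convolution operator; see [convolutionE]. *)
Definition conv phi : lop := Lop (convT_is_lop phi).

Lemma conv_linear a phi psi : conv (a *: phi + psi) = a *: conv phi + conv psi.
Proof. by apply/val_inj/funext => f; apply/val_inj/funext. Qed.

(** The probes of a bounded set form a bounded set, and convergence in the strong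
    dual is uniform on it. *)
Lemma conv_continuous : continuous conv.
Proof.
apply: (continuous_to_lop gapB) => phi M p e bM e0.
pose M' := [set g : X | exists f m zs c, [/\ M f, orthoseq (dp p) zs,
  \sum_(s <- words (nseq m zs)) normc (c s) ^+ 2 <= 1 & g = probe m zs c f]].
have bM' : test_bounded M'.
  move=> q; have [K bK] := bM (maxn p q + gain)%N.
  exists (2 * K) => _ [f [m [zs [c [Mf ozs c1 ->]]]]].
  apply: le_trans (N_mono gapB _ (leq_maxr p q)) _.
  apply: le_trans (@probe_bound p (maxn p q) m zs c f (leq_maxl _ _) ozs c1) _.
  by rewrite ler_pM2l// bK.
have e20 : 0 < e / 2 by rewrite divr_gt0.
have := near_dual phi bM' e20; apply: filterS => psi h f Mf.
have -> : conv phi f - conv psi f = conv (phi - psi) f.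
  exact/val_inj/funext.
have : (cn p (conv_fun (phi - psi)%R f) <= (2 * (e / 2) ^+ 2)%:E)%E.
  apply: conv_fun_norm => m zs c ozs c1; apply/ltW.
  by apply: (h (probe m zs c f)); exists f, m, zs, c.
rewrite -[conv_fun _ f]/(chaos (conv (phi - psi) f)) chaos_normK lee_fin => h'.
rewrite -(@ltr_pXn2r _ 2)// ?nnegrE ?test_norm_ge0 ?(ltW e0)//.
apply: le_lt_trans h' _; nra.
Qed.

End Convolution.

(** * Exponential vectors *)

(** [(2 K)^n / (n!)^(1 - beta)] is the power [1 - beta] of [a^n / n! <= exp a]. *)
Lemma weight_exponential (R : realType) (beta K : R) : beta < 1 -> 0 <= K ->
  exists2 c, 0 <= c & forall n, weight beta n * (n`!%:R^-1 ^+ 2 * K ^+ n) <= c * 2 ^- n.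
Proof.
move=> b1 K0; pose b := 1 - beta; have b0 : 0 < b by rewrite subr_gt0.
pose a := (2 * K) `^ b^-1; have a0 : 0 <= a by exact: powR_ge0.
have aK : a `^ b = 2 * K.
  by rewrite /a -powRrM mulVf ?gt_eqF// powRr1// mulr_ge0.
exists (expR a `^ b) => [|n]; first exact: powR_ge0.
have f0 : 0 < n`!%:R :> R by rewrite ltr0n fact_gt0.
have ae : a ^+ n / n`!%:R <= expR a.
  case: n {f0} => [|n]; last by apply: le_trans (expR_ge1Dxn n a0); rewrite lerDr.
  by rewrite expr0 fact0 divr1 (le_trans _ (expR_ge1Dx a))// lerDl.
rewrite ler_pdivlMr ?exprn_gt0//.
apply: (@le_trans _ _ ((a ^+ n / n`!%:R) `^ b)); last first.
  by apply: ge0_ler_powR; rewrite ?nnegrE ?divr_ge0 ?exprn_ge0 ?expR_ge0 ?(ltW b0) ?(ltW f0).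
rewrite powRM ?exprn_ge0 ?invr_ge0 ?(ltW f0)//.
have -> : (a ^+ n) `^ b = (2 * K) ^+ n.
  by rewrite -powR_mulrn// powRAC aK powR_mulrn// mulr_ge0.
rewrite exprMn.
have -> : n`!%:R^-1 `^ b = weight beta n * n`!%:R^-1 ^+ 2.
  have -> : n`!%:R^-1 `^ b = (n`!%:R `^ b)^-1.
    by rewrite -[n`!%:R^-1]powR_inv1 ?ler0n// -powRrM mulN1r powRN.
  have h : weight beta n * n`!%:R `^ b = n`!%:R ^+ 2.
    rewrite /weight -powRD; last by rewrite (gt_eqF f0) implybT.
    by rewrite -powR_mulrn ?ler0n//; congr (_ `^ _); rewrite /b; ring.
  by rewrite exprVn -h invfM mulrA divff ?mul1r// gt_eqF// weight_gt0.
by rewrite le_eqVlt; apply/orP; left; apply/eqP; ring.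
Qed.

Section Exponential.
Variables (R : realType) (V : lmodType R) (dot : V -> V -> R).
Variables (A : unbounded V) (B : V -> V) (kappa beta : R).
Hypothesis gapB : gapped_inverse dot A B kappa.
Hypotheses (beta_ge0 : 0 <= beta) (beta_lt1 : beta < 1).
Local Notation C := (R[i]^o).
Local Notation X := (test dot A beta).
Local Notation N := (@test_norm R V dot A beta).
Local Notation dp := (dotp dot B).
Local Notation w := (weight beta).
Local Notation dual := (dual dot A beta).
Local Notation D := (annihT gapB beta_ge0).
Implicit Types (phi : dual) (f : X).

Let ip := gi_ip gapB.
Let dp_ip p : inner_product (dp p) := dotp_ip (gi_ip gapB) (gi_inv gapB) (gi_lin gapB) p.

Lemma orthoseq_iter p zs : orthoseq (dp p) zs -> orthoseq dot (map (iter p B) zs).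
Proof.
elim: zs => //= z zs IH [zz zzs oz]; split => //; last exact: IH.
by move=> _ /mapP[y yzs ->]; exact: zzs.
Qed.

(** In the [p]-th inner product, the functional [dot (B^p y)] has the norm of [y]. *)
Lemma bessel_iter p zs y : orthoseq (dp p) zs ->
  \sum_(z <- zs) dot (iter p B z) y ^+ 2 <= dot y y.
Proof.
move=> /orthoseq_iter oz; rewrite -[leRHS]mul1r -(big_map (iter p B) xpredT (fun x => dot x y ^+ 2)).
have le1 x : dot x x <= 1 * dot x x by rewrite mul1r.
by have [_] := bessel_ortho ip ip ler01 le1 oz.
Qed.

Lemma iter_sym p x y : dot (iter p B x) y = dot x (iter p B y).
Proof. by elim: p x y => // p IH x y; rewrite iterSr IH (gi_sym gapB). Qed.

Definition lin_form (xi : V * V) (g : V) : R[i] := (dot xi.1 g +i* dot xi.2 g)%C.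

Lemma exp_chaosE xi s : exp_chaos dot xi s = (size s)`!%:R^-1 * \prod_(g <- s) lin_form xi g.
Proof. by []. Qed.

Lemma ssq_prod n zs (u : V -> R[i]) :
  ssq (nseq n zs) (fun s => \prod_(g <- s) u g) = (\sum_(z <- zs) normc (u z) ^+ 2) ^+ n.
Proof.
elim: n => [|n IH]; first by rewrite /ssq sum_words_nil big_nil normc1 expr1n expr0.
rewrite [nseq _ _]/= ssq_cons exprS -IH mulr_suml; apply: eq_bigr => z _.
rewrite /ssq mulr_sumr; apply: eq_bigr => s _.
by rewrite big_cons normcM exprMn.
Qed.

Lemma exp_chaos_is_test xi : testEC A xi -> exp_chaos dot xi \in @is_test R V dot A beta.
Proof.
move=> [Exi1 Exi2]; apply/asboolP; split.
- move=> s t a x y; rewrite !exp_chaosE !size_cat /= !big_cat !big_cons /=.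
  have -> : lin_form xi (a *: x + y) = a%:C%C * lin_form xi x + lin_form xi y.
    rewrite /lin_form !(ipDr ip) !(ipZr ip); apply/eqP; rewrite eq_complex /=.
    by apply/andP; split; apply/eqP; ring.
  ring.
- by move=> s t st; rewrite !exp_chaosE (perm_size st) (perm_big _ st).
move=> p.
have [y1 xi1] := (dom_powE (gi_inv gapB) p xi.1).1 (Exi1 p).
have [y2 xi2] := (dom_powE (gi_inv gapB) p xi.2).1 (Exi2 p).
pose K := dot y1 y1 + dot y2 y2.
have K0 : 0 <= K by rewrite addr_ge0 ?(ip_ge0 ip).
have [c c0 hc] := weight_exponential beta_lt1 K0.
apply: (@le_lt_trans _ _ (2 * c)%:E); last exact: ltry.
apply: (chaos_norm2_le gapB) => // n; apply: (@le_trans _ _ ((w n)%:E * (n`!%:R^-1 ^+ 2 * K ^+ n)%:E)%E).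
  apply: lee_wpmul2l; first by rewrite lee_fin ltW ?weight_gt0.
  apply: hs_le => zs ozs; rewrite lee_fin.
  rewrite (@eq_ssq_size _ _ _ _ (fun s => n`!%:R^-1 * \prod_(g <- s) lin_form xi g)); last first.
    by move=> s; rewrite size_nseq => <-.
  have -> : ssq (nseq n zs) (fun s => n`!%:R^-1 * \prod_(g <- s) lin_form xi g) =
      n`!%:R^-1 ^+ 2 * ssq (nseq n zs) (fun s => \prod_(g <- s) lin_form xi g).
    rewrite /ssq mulr_sumr; apply: eq_bigr => s _; rewrite normcM exprMn.
    by rewrite normcV normc_nat.
  rewrite ler_wpM2l ?exprn_ge0 ?invr_ge0// ssq_prod lerXn2r ?nnegrE//.
    by apply: sumr_ge0 => z _; exact: sqr_ge0.
  rewrite (eq_bigr (fun z => dot (iter p B z) y1 ^+ 2 + dot (iter p B z) y2 ^+ 2)).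
    by rewrite big_split/= lerD ?bessel_iter.
  by move=> z _; rewrite sqr_normc /= xi1 xi2 !(iter_sym p z) !(ip_sym ip z).
by rewrite -EFinM lee_fin.
Qed.

Lemma exp_vectorE xi s : testEC A xi ->
  (exp_vector dot A beta xi : X) s = exp_chaos dot xi s.
Proof.
by move=> Exi; rewrite /exp_vector insubdK//; exact: exp_chaos_is_test.
Qed.

(** Exponential vectors are multiplicative, so all annihilation operators, and hence
    all convolution operators, act on them by scalars. *)
Lemma annihT_exp xi s : testEC A xi ->
  D s (exp_vector dot A beta xi) = exp_chaos dot xi s *: exp_vector dot A beta xi.
Proof.
move=> Exi; apply/val_inj/funext => t /=.
rewrite -[RHS]/(exp_chaos dot xi s * (exp_vector dot A beta xi : X) t) /annih.
rewrite !exp_vectorE// !exp_chaosE big_cat size_cat /=.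
have fn k : k`!%:R != 0 :> R[i] by rewrite pnatr_eq0 -lt0n fact_gt0.
have := bin_fact (leq_addr (size t) (size s)); rewrite addKn => h.
rewrite -h !natrM; field.
by rewrite !fn /= pnatr_eq0 -lt0n bin_gt0 leq_addr //.
Qed.

Lemma conv_exp phi xi : testEC A xi ->
  conv gapB beta_ge0 phi (exp_vector dot A beta xi) =
  S_transform phi xi *: exp_vector dot A beta xi.
Proof.
move=> Exi; apply/val_inj/funext => s.
rewrite -[LHS]/(phi (D s (exp_vector dot A beta xi))) annihT_exp// dualZ.
by rewrite -[RHS]/(S_transform phi xi * (exp_vector dot A beta xi : X) s) exp_vectorE// mulrC.
Qed.

Definition mask (P : pred nat) (f : seq V -> C) : seq V -> C :=
  fun s => if P (size s) then f s else 0.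

Lemma hs_mask p n P (f : seq V -> C) : hs (dp p) n (mask P f) = if P n then hs (dp p) n f else 0%E.
Proof.
case: ifP => Pn; first by apply: eq_hs => s sn; rewrite /mask sn Pn.
rewrite (@eq_hs _ _ _ _ _ (fun=> 0)); last by move=> s sn; rewrite /mask sn Pn.
apply/eqP; rewrite eq_le hs_ge0 andbT; apply: hs_le => zs _.
by rewrite lee_fin /ssq big1// => s _; rewrite normc0 expr0n.
Qed.

Lemma mask_is_test P f : mask P f \in @is_test R V dot A beta.
Proof.
apply/asboolP; split.
- move=> s t a x y; rewrite /mask !size_cat /=; case: ifP => _; last by rewrite mulr0 addr0.
  exact: test_multilinear.
- by move=> s t st; rewrite /mask (perm_size st) (test_symmetric f st).
move=> p; have /asboolP[_ _ /(_ p)] := testP f; apply: le_lt_trans.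
rewrite !(chaos_norm2E _ gapB); apply: lee_nneseries => n _; first by move=> _; exact: chaos_term_ge0.
rewrite hs_mask; case: ifP => // _; rewrite mule0; exact: chaos_term_ge0.
Qed.

Definition maskT P f : X := Test (mask_is_test P f).

Lemma mask_split (psi : dual) n f :
  psi f = \sum_(m < n) psi (maskT (pred1 (m : nat)) f) + psi (maskT (leq n) f).
Proof.
rewrite -dual_sum -[X in _ = X + _]mul1r -dual_linear scale1r; congr (psi _).
apply/val_inj/funext => s.
rewrite -[RHS]/((\sum_(m < n) maskT (pred1 (m : nat)) f : X) s + mask (leq n) f s).
rewrite chaos_sum /mask /=; have [ns|sn] := leqP n (size s).
  by rewrite big1 ?add0r// => m _; rewrite /mask /= gtn_eqF// (leq_trans _ ns).
rewrite addr0 (bigD1 (Ordinal sn)) //= /mask /= eqxx big1 ?addr0// => m.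
by rewrite -val_eqE /= eq_sym => /negbTE ->.
Qed.

Lemma mask_succ (psi : dual) n f :
  psi (maskT (leq n) f) = psi (maskT (pred1 n) f) + psi (maskT (leq n.+1) f).
Proof.
rewrite -[X in _ = X + _]mul1r -dual_linear scale1r; congr (psi _).
apply/val_inj/funext => s.
rewrite -[RHS]/(mask (pred1 n) f s + mask (leq n.+1) f s) /= /mask /=.
by rewrite eq_sym; case: ltngtP => _; rewrite ?addr0 ?add0r.
Qed.

Lemma exp_scale (x : V) (t : R) s : exp_chaos dot (t *: x, 0) s = (t ^+ size s)%:C%C * exp_chaos dot (x, 0) s.
Proof.
rewrite !exp_chaosE mulrCA; congr (_ * _).
elim: s => [|g s IH]; first by rewrite !big_nil expr0 mulr1.
rewrite !big_cons IH /= exprS rmorphM mulrACA; congr (_ * _).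
rewrite /lin_form /= (ipZl ip) (ip0l ip); apply/eqP; rewrite eq_complex /=.
by apply/andP; split; apply/eqP; ring.
Qed.

Lemma testEC_real x : testE A x -> testEC A (x, 0).
Proof. by move=> Ex; split => //=; exact: (testE0 (gi_inv gapB) (gi_lin gapB)). Qed.

Lemma testEZ (t : R) x : testE A x -> testE A (t *: x).
Proof.
move=> Ex; rewrite -[t *: x]addr0.
by apply: (testE_comb (gi_inv gapB) (gi_lin gapB)) => //; exact: (testE0 (gi_inv gapB) (gi_lin gapB)).
Qed.

(* Phi stands for the exponential vectors of real arguments, of which only the
   kernels matter here. *)
Variable Phi : V -> X.
Hypothesis PhiE : forall x s, testE A x -> Phi x s = exp_chaos dot (x, 0) s.

Lemma mask_exp_scale n (t : R) x : testE A x ->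
  maskT (pred1 n) (Phi (t *: x)) = (t ^+ n)%:C%C *: maskT (pred1 n) (Phi x).
Proof.
move=> Ex.
apply/val_inj/funext => s.
rewrite -[RHS]/((t ^+ n)%:C%C * mask (pred1 n) (Phi x) s) /= /mask /=.
case: eqP => [<-|_]; last by rewrite mulr0.
by rewrite !PhiE ?exp_scale//; exact: testEZ.
Qed.

(** Induction on [n]: along the ray [t *: x] the components of order below [n] are
    killed, the one of order [n] scales like [t^n] and the rest is [O(t^(n + 1))]. *)
Lemma functional_homogeneous (psi : dual) :
  (forall x, testE A x -> psi (Phi x) = 0) ->
  forall n x, testE A x -> psi (maskT (pred1 n) (Phi x)) = 0.
Proof.
move=> psi0; elim/ltn_ind => n IH x Ex.
have [q [K K0 bpsi]] := dual_bound gapB psi.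
apply: eq0_normc; apply: (@le_geometric_eq0 _ _ (K * N q (Phi x))); first exact: normc_ge0.
move=> j; pose t : R := 2 ^- j.
have t0 : 0 < t by rewrite invr_gt0 exprn_gt0.
have t1 : t <= 1 by rewrite invf_le1 ?exprn_gt0// exprn_ege1// ler1n.
have Et := testEZ t Ex.
have : psi (Phi (t *: x)) = 0 by exact: psi0.
rewrite (mask_split psi n) big1; last by move=> m _; exact: IH.
rewrite add0r mask_succ.
rewrite mask_exp_scale// dualZ => /eqP; rewrite addr_eq0 => /eqP h.
have tn : 0 < t ^+ n by rewrite exprn_gt0.
rewrite -(ler_pM2l tn).
have -> : t ^+ n * normc (psi (maskT (pred1 n) (Phi x))) =
    normc (psi (maskT (leq n.+1) (Phi (t *: x)))).
  rewrite -[in RHS](opprK (psi _)) -h normcN normcM normc_real gtr0_norm//.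
apply: le_trans (bpsi _) _; rewrite mulrCA -mulrA ler_wpM2l//.
rewrite -[_ / 2 ^+ j]/(t ^+ n * t) -exprSr mulrC -(@ler_pXn2r _ 2)// ?nnegrE ?mulr_ge0 ?test_norm_ge0 ?exprn_ge0 ?(ltW t0)//.
rewrite exprMn -lee_fin [leRHS]EFinM -!chaos_normK !(chaos_norm2E _ gapB).
rewrite -nneseriesZl; last by move=> m _; exact: chaos_term_ge0.
apply: lee_nneseries => [m _ _|m _]; first exact: chaos_term_ge0.
rewrite hs_mask; case: ifP => [nm|_]; last first.
  by rewrite mule0 mule_ge0 ?chaos_term_ge0// lee_fin exprn_ge0// exprn_ge0// ltW.
rewrite muleCA; apply: lee_wpmul2l; first by rewrite lee_fin ltW ?weight_gt0.
apply: hs_le => zs ozs.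
rewrite (@eq_ssq_size _ _ _ _ (fun s => (t ^+ m)%:C%C * Phi x s)); last first.
  by move=> s; rewrite size_nseq => sm; rewrite !PhiE// exp_scale sm.
apply: (@le_trans _ _ (((t ^+ n.+1) ^+ 2)%:E * (ssq (nseq m zs) (Phi x))%:E)%E).
  rewrite -EFinM lee_fin /ssq mulr_sumr; apply: ler_sum => s _.
  rewrite normcM exprMn ler_wpM2r ?sqr_ge0// normc_real ger0_norm ?exprn_ge0 ?(ltW t0)//.
  by rewrite lerXn2r ?nnegrE ?exprn_ge0 ?(ltW t0)// ler_wiXn2l ?(ltW t0).
by apply: lee_wpmul2l; [rewrite lee_fin sqr_ge0|exact: hs_ge].
Qed.

End Exponential.

(** * Finite-rank approximation of multilinear forms *)

Section Approximation.
Variables (R : realType) (V : lmodType R).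
Local Notation C := (R[i]^o).
Implicit Types (f : seq V -> C) (d : V -> V -> R).

Lemma multilinear0 f u t : multilinear f -> f (u ++ 0 :: t) = 0.
Proof.
by move=> fm; have := fm u t (-1) 0 0; rewrite scaleN1r addNr raddfN /= mulN1r addNr.
Qed.

Lemma ssq_cat F G f : ssq (F ++ G) f = \sum_(u <- words F) ssq G (fun t => f (u ++ t)).
Proof. exact: sum_words_cat. Qed.

Lemma ssq_map n (g : V -> V) xs f :
  ssq (nseq n (map g xs)) f = ssq (nseq n xs) (fun s => f (map g s)).
Proof. by rewrite /ssq -map_nseq words_map big_map. Qed.

Section Projection.
Variables (d : V -> V -> R) (ipd : inner_product d).

Lemma orthoseq_catP e zs : orthoseq d (e ++ zs) ->
  [/\ orthoseq d e, orthoseq d zs & forall x y, x \in e -> y \in zs -> d x y = 0].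
Proof.
elim: e => [|x e IH] /=; first by move=> oz; split.
move=> [xx xe /IH[oe oz ez]]; split=> //; first by split=> // y ye; rewrite xe// mem_cat ye.
move=> a y; rewrite inE => /predU1P[->|]; last exact: ez.
by move=> yz; rewrite xe// mem_cat yz orbT.
Qed.

Lemma sum_proj_words n e zs f : orthoseq d (e ++ zs) -> multilinear f ->
  ssq (nseq n (e ++ zs)) (fun s => f (map (proj d zs) s)) = ssq (nseq n zs) f.
Proof.
move=> oez; have [oe oz ez] := orthoseq_catP oez.
elim: n f => [|n IH] f fm; first by rewrite /ssq !sum_words_nil.
rewrite [nseq _ _]/= [nseq n.+1 zs]/= !ssq_cons big_cat/= [X in X + _]big1_seq ?add0r.
  rewrite big_seq [RHS]big_seq; apply: eq_bigr => z zz.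
  by rewrite -IH ?proj_id//; exact: multilinear_cons.
move=> x /= xe; rewrite /ssq big1// => s _ /=.
rewrite proj_orth; last by move=> y yz; rewrite (ip_sym ipd) ez.
by rewrite (multilinear0 [::])// normc0 expr0n.
Qed.

(** On a word over [e ++ zs], composition with the projection onto the span of [zs]
    either changes nothing or gives zero, so the two parts are orthogonal. *)
Lemma ssq_sub_proj n e zs f : orthoseq d (e ++ zs) -> multilinear f ->
  ssq (nseq n (e ++ zs)) (fun s => f s - f (map (proj d zs) s)) =
  ssq (nseq n (e ++ zs)) f - ssq (nseq n zs) f.
Proof.
move=> oez fm; rewrite -(sum_proj_words n oez fm); apply/eqP; rewrite eq_sym subr_eq; apply/eqP.
have [oe oz ez] := orthoseq_catP oez.
rewrite /ssq -big_split/=; apply: eq_big_seq => s.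
rewrite mem_words_nseq => /andP[_ /allP sall].
have [sz|] := boolP (all [in zs] s).
  have -> : map (proj d zs) s = s.
    by rewrite -[RHS]map_id; apply/eq_in_map => x /(allP sz) xz; exact: proj_id.
  by rewrite subrr normc0 expr0n add0r.
move=> /allPn[x xs xz].
have -> : f (map (proj d zs) s) = 0.
  case/splitPr: xs sall => s1 s2 sall; rewrite map_cat /= proj_orth.
    exact: multilinear0.
  move=> y yz; rewrite (ip_sym ipd); apply: ez => //.
  have := sall x; rewrite mem_cat mem_head orbT mem_cat => /(_ isT).
  by rewrite (negPf xz) orbF.
by rewrite subr0 normc0 expr0n addr0.
Qed.

(** A finite orthonormal family that nearly attains the supremum defining [hs] captures
    [f] up to a small error. *)
Lemma hs_sub_proj n zs f (eta : R) : orthoseq d zs -> multilinear f ->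
  (hs d n f <= (ssq (nseq n zs) f + eta)%:E)%E ->
  (hs d n (fun s => f s - f (map (proj d zs) s))%R <= eta%:E)%E.
Proof.
move=> ozs fm hf; apply: hs_le => ys oys.
have [e [oe pe]] := gram_schmidt ipd ys ozs.
have gm : multilinear (fun s => f s - f (map (proj d zs) s)).
  move=> s t a x y; rewrite fm !map_cat /= (proj_linear ipd) fm; ring.
apply: (@le_trans _ _ (ssq (nseq n (e ++ zs)) (fun s => f s - f (map (proj d zs) s)))%:E).
  have := @ssq_span _ _ d (nseq n (1, ys)) (e ++ zs) _ ipd oe _ _ gm.
  rewrite map_nseq size_nseq prod_nseq expr1n mul1r lee_fin; apply.
    move=> cx; rewrite mem_nseq => /andP[_ /eqP ->] /=.
    by apply: (bessel_ortho ipd ipd) => // x; rewrite mul1r.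
  by move=> cx x; rewrite mem_nseq => /andP[_ /eqP ->] /=; exact: pe.
rewrite (ssq_sub_proj n oe fm) lee_fin lerBlDl -lee_fin.
by apply: le_trans hf; exact: hs_ge.
Qed.

Lemma bessel_proj zs hs : orthoseq d zs -> orthoseq d hs -> bessel d 1 (map (proj d zs) hs).
Proof.
move=> oz oh; split=> // y; rewrite big_map mul1r.
have b xs : orthoseq d xs -> forall x, \sum_(z <- xs) d z x ^+ 2 <= d x x.
  have le1 x : d x x <= 1 * d x x by rewrite mul1r.
  by move=> oxs x; have [_ /(_ x)] := bessel_ortho ipd ipd ler01 le1 oxs; rewrite mul1r.
rewrite (eq_bigr (fun x => d x (proj d zs y) ^+ 2)); last first.
  move=> x _; rewrite /proj (ip_suml ipd) (ip_sumr ipd); congr (_ ^+ 2).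
  by apply: eq_bigr => z _; rewrite (ipZl ipd) (ipZr ipd) (ip_sym ipd x) mulrC.
apply: le_trans (b _ oh _) _; rewrite /proj (ortho_comb ipd (fun z => d z y))//.
exact: b.
Qed.

(** Replace [P] by [P - T] one slot at a time. The list [G] stands for the slots already
    treated; it has to be part of the induction, since the supremum in [hs] cannot be
    exchanged with the sum over their words. The constant solves
    [c (n + 1) = 2 + 8 c n]. *)
Lemma ssq_telescope (P T : V -> V) xs (e : R) n (G : seq (R * seq V)) f :
  0 <= e -> e <= 1 -> multilinear f ->
  bessel d 1 (map P xs) -> bessel d e (map T xs) ->
  (forall cx, cx \in G -> bessel d cx.1 cx.2) ->
  ((\sum_(u <- words [seq cx.2 | cx <- G])
     ssq (nseq n xs) (fun t => f (u ++ map P t) - f (u ++ map (fun x => P x - T x) t))%R)%:E <=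
   (e * (9 ^+ n - 1) * \prod_(cx <- G) cx.1)%:E * hs d (size G + n) f)%E.
Proof.
move=> e0 e1 fm [_ bP] [_ bT]; elim: n G => [|n IH] G bG.
  rewrite big1; last by move=> u _; rewrite /ssq sum_words_nil /= subrr normc0 expr0n.
  by rewrite expr0 subrr mulr0 mul0r mul0e.
set Q := fun x => P x - T x.
have P0 : 0 <= \prod_(cx <- G) cx.1 by rewrite big_seq prodr_ge0// => cx /bG[].
have bQ : bessel d 4 (map Q xs).
  split=> // y; rewrite big_map.
  apply: (@le_trans _ _ (2 * (\sum_(x <- xs) d (P x) y ^+ 2) + 2 * (\sum_(x <- xs) d (T x) y ^+ 2))).
    rewrite !mulr_sumr -big_split/=; apply: ler_sum => x _; rewrite /Q (ipBl ipd).
    have := sqr_ge0 (d (P x) y + d (T x) y); lra.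
  have := bP y; have := bT y; rewrite !big_map => h1 h2.
  have := ip_ge0 ipd y; nra.
pose G1 := G ++ (e, map T xs) :: nseq n (1, map P xs).
have bG1 cx : cx \in G1 -> bessel d cx.1 cx.2.
  rewrite mem_cat inE mem_nseq => /orP[|/orP[/eqP ->|/andP[_ /eqP ->]]] //; exact: bG.
have h1 := ssq_le_hs ipd bG1 fm.
pose G2 := G ++ [:: (4, map Q xs)].
have bG2 cx : cx \in G2 -> bessel d cx.1 cx.2.
  by rewrite mem_cat inE => /orP[|/eqP ->] //; exact: bG.
have h2 := IH G2 bG2.
move: h1; rewrite /G1 map_cat size_cat /= map_nseq size_nseq big_cat big_cons prod_nseq /= expr1n mulr1 => h1.
move: h2; rewrite /G2 map_cat size_cat /= big_cat big_seq1 /= addn1 addSnnS => h2.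
set H := hs d (size G + n.+1) f in h1 h2 *.
rewrite [nseq _ _]/=.
apply: (@le_trans _ _ (2%:E * ((ssq ([seq cx.2 | cx <- G] ++ map T xs :: nseq n (map P xs)) f)%:E +
  (\sum_(u <- words ([seq cx.2 | cx <- G] ++ [:: map Q xs]))
     ssq (nseq n xs) (fun t => f (u ++ map P t) - f (u ++ map Q t))%R)%:E))%E).
  rewrite -EFinD -EFinM lee_fin ssq_cat sum_words_cat -big_split mulr_sumr.
  apply: ler_sum => u _; rewrite !ssq_cons big_map sum_words_cons big_map -big_split mulr_sumr.
  apply: ler_sum => x _; rewrite ssq_map sum_words_nil /ssq -big_split mulr_sumr.
  apply: ler_sum => t _; rewrite -!catA /=; apply: le_trans (sqnormcD _ _).
  rewrite le_eqVlt; apply/orP; left; apply/eqP; congr (normc _ ^+ 2).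
  have := fm u (map P t) (-1) (T x) (P x); rewrite scaleN1r addrC -/(Q x) => ->.
  by rewrite raddfN /= mulN1r; ring.
apply: (@le_trans _ _ (2%:E * ((\prod_(i <- G) i.1 * e)%:E * H +
   (e * (9 ^+ n - 1) * (\prod_(i <- G) i.1 * 4))%:E * H))%E).
  by apply: lee_wpmul2l => //; exact: leeD.
have n9 : 1 <= 9 ^+ n :> R by rewrite exprn_ege1// ler1n.
rewrite -ge0_muleDl ?lee_fin ?mulr_ge0 ?subr_ge0// muleA -EFinD -EFinM.
apply: lee_wpmul2r; first exact: hs_ge0.
rewrite lee_fin exprS.
have -> : 2 * (\prod_(i <- G) i.1 * e + e * (9 ^+ n - 1) * (\prod_(i <- G) i.1 * 4)) =
  (e * \prod_(i <- G) i.1) * (2 + 8 * (9 ^+ n - 1)) by ring.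
have -> : e * (9 * 9 ^+ n - 1) * \prod_(cx <- G) cx.1 =
  (e * \prod_(i <- G) i.1) * (9 * 9 ^+ n - 1) by ring.
by apply: ler_wpM2l; [exact: mulr_ge0|lra].
Qed.

End Projection.

End Approximation.

(** * Polarization and totality of the exponential vectors *)

Section Polarization.

(** Expand the product over functions [f] from slots to indices: the alternating sum
    over the sets [S] containing the range of [f] vanishes unless the range is
    everything, that is, unless [f] is a permutation. *)
Lemma polarization (K : comPzRingType) n (u : 'I_n -> 'I_n -> K) :
  \sum_(S : {set 'I_n}) (-1) ^+ (n - #|S|) * \prod_(i < n) \sum_(l in S) u l i =
  \sum_(s : 'S_n) \prod_(i < n) u (s i) i.
Proof.
under eq_bigr do rewrite (bigA_distr_big _ (fun i l => u l i)) mulr_sumr.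
rewrite (exchange_big_dep predT)//=.
rewrite (bigID (fun f : {ffun 'I_n -> 'I_n} => injectiveb f)) /= [X in _ + X]big1 ?addr0.
  rewrite (reindex (fun s : 'S_n => pval s)) /=.
    apply: eq_big => [s|s _]; first exact: (valP s).
    rewrite (big_pred1 [set: 'I_n]%SET) /=; first by rewrite cardsT card_ord subnn expr0 mul1r; apply: eq_bigr => i _; rewrite pvalE.
    move=> S; apply/ffun_onP/eqP => [h|->] //.
    apply/setP => x; rewrite inE; have := h ((s^-1)%g x).
    by rewrite pvalE permKV.
  by exists (insubd (1%g : 'S_n)) => f /= fi; first apply: val_inj; apply: insubdK.
move=> f finj; rewrite -mulr_suml [X in X * _](_ : _ = 0) ?mul0r//.
have [y yf] : exists y, y \notin codom f.
  apply/existsP; apply: contraR finj; rewrite negb_exists => /forallP h.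
  apply: (introT card_uniqP); rewrite size_map -cardE; apply: eq_card => y.
  by rewrite [RHS]inE; exact: negbNE.
rewrite (bigID (fun S : {set 'I_n} => y \in S)) /=.
rewrite (reindex_onto (fun S : {set 'I_n} => y |: S) (fun S => S :\ y)) /=; last first.
  by move=> S /andP[_ yS]; rewrite finset.setD1K.
rewrite (eq_bigl (fun S : {set 'I_n} => (f \in ffun_on (fun x => x \in S)) && (y \notin S))) => [|S]; last first.
  rewrite setU11 andbT; have [yS|yS] := boolP (y \in S).
    rewrite andbF; apply/negbTE; rewrite negb_and; apply/orP; right.
    by apply/eqP => /setP /(_ y); rewrite !inE eqxx yS.
  rewrite setU1K// eqxx !andbT; apply/ffun_onP/ffun_onP => h x; last by rewrite inE h orbT.
  have := h x; rewrite !inE => /predU1P[fx|//].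
  by rewrite -fx codom_f in yf.
rewrite -big_split big1//= => S /andP[_ yS].
have := max_card (mem (y |: S)); rewrite cardsU1 yS card_ord add1n => Sn.
by rewrite -(subnSK Sn) exprS mulN1r addrC addNr.
Qed.

End Polarization.

Section Totality.
Variables (R : realType) (V : lmodType R) (dot : V -> V -> R).
Variables (A : unbounded V) (B : V -> V) (kappa beta : R).
Hypothesis gapB : gapped_inverse dot A B kappa.
Hypothesis beta_ge0 : 0 <= beta.
Local Notation C := (R[i]^o).
Local Notation X := (test dot A beta).
Local Notation N := (@test_norm R V dot A beta).
Local Notation dp := (dotp dot B).
Local Notation w := (weight beta).
Local Notation dual := (dual dot A beta).
Implicit Types (phi psi : dual) (f : X).

Let ip := gi_ip gapB.
Let dp_ip p : inner_product (dp p) := dotp_ip (gi_ip gapB) (gi_inv gapB) (gi_lin gapB) p.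

Lemma testE_sum (I : Type) (r : seq I) (P : pred I) (x : I -> V) :
  (forall i, testE A (x i)) -> testE A (\sum_(i <- r | P i) x i).
Proof.
move=> Ex; apply: (big_ind (testE A)) => //.
  exact: (testE0 (gi_inv gapB) (gi_lin gapB)).
move=> a b Ea Eb; rewrite -[a]scale1r.
exact: (testE_comb (gi_inv gapB) (gi_lin gapB)).
Qed.

Variable Phi : V -> X.
Hypothesis PhiE : forall x s, testE A x -> Phi x s = exp_chaos dot (x, 0) s.

Definition tensor_power n y : X := n`!%:R *: maskT gapB (pred1 n) (Phi y).

Lemma tensor_powerE n y s : testE A y ->
  tensor_power n y s = if size s == n then \prod_(g <- s) (dot y g)%:C%C else 0.
Proof.
move=> Ey; rewrite -[LHS]/(n`!%:R * mask (pred1 n) (Phi y) s) /mask /=.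
case: eqP => [<-|_]; last by rewrite mulr0.
rewrite PhiE// exp_chaosE mulrA mulfV ?mul1r; last by rewrite pnatr_eq0 -lt0n fact_gt0.
by apply: eq_bigr => g _; rewrite /lin_form /= (ip0l ip).
Qed.

(** By polarization, the symmetrized product of the vectors [x i] is a combination
    of tensor powers. *)
Definition sym_tensor n (x : 'I_n -> V) : X :=
  \sum_(S : {set 'I_n}) ((-1) ^+ (n - #|S|)) *: tensor_power n (\sum_(l in S) x l).

Lemma sym_tensorE n (x : 'I_n -> V) s : (forall l, testE A (x l)) ->
  sym_tensor x s = if size s == n then
    \sum_(p : 'S_n) \prod_(i < n) (dot (x (p i)) s`_i)%:C%C else 0.
Proof.
move=> Ex; rewrite /sym_tensor chaos_sum.
rewrite (eq_bigr (fun S : {set 'I_n} => (-1) ^+ (n - #|S|) *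
    (if size s == n then \prod_(g <- s) (dot (\sum_(l in S) x l) g)%:C%C else 0))); last first.
  by move=> S _; rewrite chaosZ tensor_powerE//; exact: testE_sum.
case: eqP => [sn|_]; last by rewrite big1// => S _; rewrite mulr0.
rewrite -(polarization (fun l i => (dot (x l) s`_i)%:C%C)); apply: eq_bigr => S _.
congr (_ * _); rewrite (big_nth 0) big_mkord sn; apply: eq_bigr => i _.
by rewrite -[\sum_(l in S) x l]big_filter (ip_suml ip) big_filter raddf_sum.
Qed.

Section Combination.
Variables (n k : nat) (x z : 'I_k -> V) (f : X).
Hypothesis Ex : forall l, testE A (x l).

Definition combination : X := \sum_(j : n.-tuple 'I_k)
  (n`!%:R^-1 * f [seq z l | l <- j]) *: sym_tensor (fun i => x (tnth j i)).

Lemma combinationE s : combination s = if size s == n then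
  \sum_(j : n.-tuple 'I_k) f [seq z l | l <- j] *
    \prod_(i < n) (dot (x (tnth j i)) s`_i)%:C%C else 0.
Proof.
rewrite /combination chaos_sum.
under eq_bigr => j _ do rewrite chaosZ (sym_tensorE _ (fun i => Ex (tnth j i))).
case: eqP => [sn|_]; last by rewrite big1// => S _; rewrite mulr0.
pose a (j : n.-tuple 'I_k) := f [seq z l | l <- j].
pose c (l : 'I_k) (i : 'I_n) : R[i] := (dot (x l) s`_i)%:C%C.
transitivity (n`!%:R^-1 * \sum_(p : 'S_n) \sum_(j : n.-tuple 'I_k)
    a j * \prod_(i < n) c (tnth j (p i)) i).
  rewrite exchange_big mulr_sumr; apply: eq_bigr => j _.
  by rewrite -mulrA; congr (_ * _); rewrite mulr_sumr.
rewrite (eq_bigr (fun=> \sum_(j : n.-tuple 'I_k) a j * \prod_(i < n) c (tnth j i) i)).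
  rewrite sumr_const card_Sn -[X in _ * X]mulr_natl mulrA mulVf ?mul1r//.
move=> p _; pose h (q : 'S_n) (j : n.-tuple 'I_k) : n.-tuple 'I_k := [tuple tnth j (q i) | i < n].
have hh q r j : h q (h r j) = h (q * r)%g j.
  by apply: eq_from_tnth => i; rewrite !tnth_mktuple permM.
have h1 j : h 1%g j = j.
  by apply: eq_from_tnth => i; rewrite !tnth_mktuple perm1.
rewrite (reindex (h (p^-1)%g)) /=; last first.
  by exists (h p) => j _; rewrite hh ?mulVg ?mulgV h1.
apply: eq_bigr => j _; congr (_ * _).
  apply: (test_symmetric f); apply: perm_map.
  by apply/tuple_permP; exists (p^-1)%g.
by apply: eq_bigr => i _; rewrite tnth_mktuple permK.
Qed.

End Combination.

Lemma multilinear_sum (g : seq V -> C) u t (I : Type) (r : seq I) (c : I -> R) (y : I -> V) :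
  multilinear g ->
  g (u ++ (\sum_(i <- r) c i *: y i) :: t) = \sum_(i <- r) (c i)%:C%C * g (u ++ y i :: t).
Proof.
move=> gm; elim: r => [|i r IH]; first by rewrite !big_nil multilinear0.
by rewrite !big_cons gm IH.
Qed.

Lemma multilinear_expand (g : seq V -> C) u zs (e : V -> V) s : multilinear g ->
  g (u ++ map (fun y => \sum_(z <- zs) dot (e z) y *: z) s) =
  \sum_(t <- words (nseq (size s) zs))
    (\prod_(i < size s) (dot (e t`_i) s`_i)%:C%C) * g (u ++ t).
Proof.
move=> gm; elim: s u => [|y s IH] u; first by rewrite sum_words_nil big_ord0 mul1r.
rewrite [size _]/= [nseq _ _]/= sum_words_cons /= (multilinear_sum _ _ _ _ _ gm).
apply: eq_bigr => z _; rewrite -cat_rcons IH mulr_sumr; apply: eq_bigr => t _.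
by rewrite big_ord_recl /= cat_rcons mulrA.
Qed.

Lemma words_combination (f : X) n zs (e : V -> V) : (forall z, testE A (e z)) ->
  exists F : X, (forall psi : dual, (forall m x, testE A x -> psi (maskT gapB (pred1 m) (Phi x)) = 0) ->
     psi F = 0) /\
   forall s, F s = if size s == n then
     f (map (fun y => \sum_(z <- zs) dot (e z) y *: z) s) else 0.
Proof.
move=> Ee; pose z (l : 'I_(size zs)) := zs`_l.
exists (combination n (fun l => e (z l)) z f); split=> [psi psi0|s].
  rewrite /combination dual_sum big1// => j _; rewrite dualZ.
  rewrite /sym_tensor dual_sum big1 ?mulr0// => S _; rewrite !dualZ psi0 ?mulr0//.
  exact: testE_sum.
rewrite combinationE//; case: eqP => // sn.
rewrite (multilinear_expand [::] _ _ _ (test_multilinear f)) sn.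
have zsE : zs = map z (enum 'I_(size zs)).
  by rewrite -{1}(mkseq_nth 0 zs) /mkseq -val_enum_ord -map_comp.
rewrite [X in nseq n X]zsE -map_nseq words_map big_map.
rewrite (sum_words_tuple n (fun t => (\prod_(i < n) (dot (e (map z t)`_i) s`_i)%:C%C) * f (map z t))).
apply: eq_bigr => j _; rewrite mulrC; congr (_ * _); apply: eq_bigr => i _.
by rewrite -[map z j]/(tval (map_tuple z j)) -tnth_nth tnth_map.
Qed.

Lemma hsD p n (f g : seq V -> C) :
  (hs (dp p) n (f \+ g)%R <= 2%:E * (hs (dp p) n f + hs (dp p) n g))%E.
Proof. by rewrite -!(tnorm2_hs gapB); exact: tnorm2D. Qed.

(** First [f] is replaced by its composition with the projection onto a nearly optimal
    orthonormal family [zs]. That amounts to a combination of products of the vectors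
    [B^(2q) z], which are then moved into the test space by approximating [B^q z],
    for the norm of the ambient space, by test vectors. *)
Lemma density (f : X) q n (eta : R) : 0 < eta ->
  exists zs (e : V -> V), (forall z, testE A (e z)) /\
   (hs (dp q) n (fun s => f s - f (map (fun y => \sum_(z <- zs) dot (e z) y *: z) s))%R
    <= eta%:E)%E.
Proof.
move=> eta0; have fm := test_multilinear f.
have Hfin : hs (dp q) n f \is a fin_num.
  rewrite ge0_fin_numE ?hs_ge0//.
  have := chaos_term_le beta gapB q f n; rewrite chaos_normK => h.
  have : (hs (dp q) n f <= (N q f ^+ 2)%:E)%E.
    apply: le_trans h; rewrite -[leLHS]mul1e; apply: lee_wpmul2r; first exact: hs_ge0.
    by rewrite lee_fin weight_ge1.
  by move=> /le_lt_trans; apply; exact: ltry.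
pose H := fine (hs (dp q) n f).
have HE : hs (dp q) n f = H%:E by rewrite fineK.
have H0 : 0 <= H by rewrite fine_ge0// hs_ge0.
have eta4 : 0 < eta / 4 by rewrite divr_gt0.
have [_ [zs ozs ->] hz] := ub_ereal_sup_adherent eta4 Hfin.
have {}hz : (hs (dp q) n f <= (ssq (nseq n zs) f + eta / 4)%:E)%E.
  by rewrite EFinD -leeBlDr//; exact: ltW.
pose ep := (eta / 4) / (eta / 4 + 9 ^+ n * H).
have n9 : 0 <= 9 ^+ n * H by rewrite mulr_ge0// exprn_ge0.
have ep0 : 0 < ep by rewrite divr_gt0// ltr_wpDr.
have ep1 : ep <= 1 by rewrite ler_pdivrMr ?mul1r ?lerDl// ltr_wpDr.
have epH : ep * (9 ^+ n * H) <= eta / 4.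
  rewrite /ep mulrAC ler_pdivrMr ?ltr_wpDr// ler_wpM2l ?(ltW eta4)//.
  by rewrite lerDr ltW.
pose del := Num.sqrt (ep / (size zs).+1%:R).
have del0 : 0 < del by rewrite sqrtr_gt0 divr_gt0.
have near z : exists2 y, testE A y & norm0 dot (iter q B z - y) <= del.
  exact: (gi_dense gapB).
pose e' z := projT1 (cid2 (near z)).
have Ee' z : testE A (e' z) by rewrite /e'; case: cid2.
have e'P z : norm0 dot (iter q B z - e' z) <= del by rewrite /e'; case: cid2.
exists zs, (fun z => iter q B (e' z)); split.
  by move=> z; exact: (testE_iter (gi_inv gapB)).
pose P := proj (dp q) zs.
pose T y := \sum_(z <- zs) dot (iter q B z - e' z) (iter q B y) *: z.
have QE y : \sum_(z <- zs) dot (iter q B (e' z)) y *: z = P y - T y.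
  rewrite /P /proj /T -sumrB; apply: eq_bigr => z _; rewrite -scalerBl; congr (_ *: _).
  by rewrite (iter_sym gapB) /dotp (ipBl ip) opprB addrC subrK.
rewrite (@eq_hs _ _ _ _ _ ((fun s => f s - f (map P s)) \+
   (fun s => f (map P s) - f (map (fun y => P y - T y) s)))); last first.
  by move=> s _ /=; rewrite addrA subrK (eq_map QE).
apply: (le_trans (hsD _ _ _ _)).
apply: (@le_trans _ _ (2%:E * ((eta / 4)%:E + (eta / 4)%:E))%E); last first.
  by rewrite -EFinD -EFinM lee_fin; lra.
apply: lee_wpmul2l => //; apply: leeD.
  exact: (hs_sub_proj (dp_ip q) ozs fm hz).
apply: (@le_trans _ _ ((ep * (9 ^+ n - 1))%:E * H%:E)%E); last first.
  rewrite -EFinM lee_fin; apply: le_trans epH; rewrite -mulrA ler_wpM2l ?(ltW ep0)//.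
  by rewrite ler_wpM2r// gerBl.
rewrite -HE; apply: hs_le => hs ohs.
have bT : bessel (dp q) ep (map T hs).
  split=> [|y]; first exact: ltW.
  rewrite big_map.
  have le1 x : dp q x x <= 1 * dp q x x by rewrite mul1r.
  have bz := bessel_ortho (dp_ip q) (dp_ip q) ler01 le1 ozs.
  have [_ /(_ y) by1] := bz; rewrite mul1r in by1.
  have y0 := ip_ge0 (dp_ip q) y.
  apply: (@le_trans _ _ (\sum_(x <- hs) (\sum_(z <- zs) dot (iter q B z - e' z) (iter q B x) ^+ 2) * dp q y y)).
    apply: ler_sum => x _; rewrite /T (ip_suml (dp_ip q)).
    under eq_bigr do rewrite (ipZl (dp_ip q)).
    apply: le_trans (sum_cauchy_schwarz _ _ _) _; apply: ler_wpM2l => //.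
    by apply: sumr_ge0 => z _; exact: sqr_ge0.
  rewrite -mulr_suml ler_wpM2r// exchange_big/=.
  apply: (@le_trans _ _ (\sum_(z <- zs) del ^+ 2)).
    apply: ler_sum => z _; apply: (@le_trans _ _ (norm0 dot (iter q B z - e' z) ^+ 2)).
      rewrite (sqr_norm0 ip).
      under eq_bigr do rewrite (ip_sym ip).
      exact: (bessel_iter gapB).
    by rewrite lerXn2r ?nnegrE ?norm0_ge0 ?(ltW del0).
  rewrite big_const_seq count_predT iter_addr_0 -[leLHS]mulr_natr sqr_sqrtr.
    rewrite mulrAC ler_pdivrMr// ler_wpM2l ?(ltW ep0)// ler_nat //.
  by rewrite divr_ge0// ltW.
have bP := bessel_proj (dp_ip q) ozs ohs.
have := @ssq_telescope _ _ _ (dp_ip q) P T hs ep n [::] f (ltW ep0) ep1 fm bP bT.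
rewrite /= big_seq1 big_nil mulr1 /= add0n; apply.
by move=> cx.
Qed.

Lemma functional_mask0 psi :
  (forall m x, testE A x -> psi (maskT gapB (pred1 m) (Phi x)) = 0) ->
  forall n f, psi (maskT gapB (pred1 n) f) = 0.
Proof.
move=> psi0 n f; have [q [K K0 bpsi]] := dual_bound gapB psi.
apply: eq0_normc; apply: (@le_geometric_eq0 _ _ (K * 1)); first exact: normc_ge0.
move=> j; pose eta : R := (2 ^- j) ^+ 2 / (2 * (2 ^+ n * w n)).
have wn := weight_gt0 beta n.
have j0 : 0 < 2 ^- j :> R by rewrite invr_gt0 exprn_gt0.
have wn2 : 0 < 2 * (2 ^+ n * w n) by rewrite !mulr_gt0// exprn_gt0.
have eta0 : 0 < eta by rewrite divr_gt0// exprn_gt0.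
have [zs [e [Ee he]]] := density f q n eta0.
have [F [F0 FE]] := words_combination f n zs Ee.
have -> : psi (maskT gapB (pred1 n) f) = psi (maskT gapB (pred1 n) f - F).
  by rewrite addrC -scaleN1r dual_linear F0// mulr0 add0r.
apply: le_trans (bpsi _) _; rewrite -mulrA ler_wpM2l// mul1r.
rewrite -(@ler_pXn2r _ 2)// ?nnegrE ?test_norm_ge0 ?(ltW j0)//.
rewrite -lee_fin -chaos_normK.
have -> : chaos (maskT gapB (pred1 n) f - F) = mask (pred1 n)
    (fun s => f s - f [seq \sum_(z <- zs) dot (e z) y *: z | y <- s]).
  apply/funext => s; rewrite -[LHS]/(mask (pred1 n) f s - F s) FE /mask /=.
  by case: eqP => // _; rewrite subrr.
have -> : (2 ^- j) ^+ 2 = 2 * (2 ^+ n * w n * eta).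
  by rewrite /eta mulrC -[LHS]mulr1; field; rewrite !gt_eqF ?exprn_gt0.
have c0 : 0 <= 2 ^+ n * w n * eta.
  by apply: mulr_ge0; [apply: mulr_ge0; [exact: exprn_ge0|exact: ltW]|exact: ltW].
apply: (chaos_norm2_le gapB c0).
move=> m; rewrite hs_mask /=; case: eqP => [->|_]; last first.
  by rewrite mule0 lee_fin; apply: mulr_ge0; rewrite ?invr_ge0 ?exprn_ge0.
apply: (@le_trans _ _ ((w n)%:E * eta%:E)%E).
  by apply: lee_wpmul2l; [rewrite lee_fin ltW|].
rewrite -EFinM lee_fin le_eqVlt; apply/orP; left; apply/eqP; field.
by rewrite gt_eqF// exprn_gt0.
Qed.

Lemma functional_total psi :
  (forall x, testE A x -> psi (Phi x) = 0) -> forall f, psi f = 0.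
Proof.
move=> psi0 f; have [q [K K0 bpsi]] := dual_bound gapB psi.
have mask0 := functional_mask0 (functional_homogeneous gapB PhiE psi0).
apply: eq0_normc; apply: (@le_geometric_eq0 _ _ (K * (2 * N (q + gain gapB) f))); first exact: normc_ge0.
move=> n; rewrite (mask_split gapB psi n f) big1 ?add0r; last by move=> m _; exact: mask0.
have N0 := test_norm_ge0 (q + gain gapB) f.
have n0 : 0 <= 2 ^- n :> R by rewrite invr_ge0 exprn_ge0.
apply: le_trans (bpsi _) _; rewrite -mulrA ler_wpM2l//.
rewrite -(@ler_pXn2r _ 2)// ?nnegrE ?test_norm_ge0 ?mulr_ge0//.
rewrite -lee_fin -chaos_normK.
apply: (@le_trans _ _ (2 * (8 ^- n * N (q + gain gapB) f ^+ 2))%:E).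
  apply: (chaos_norm2_le gapB); first by rewrite mulr_ge0 ?invr_ge0 ?exprn_ge0.
  move=> m; rewrite hs_mask /=; case: ifP => [nm|_]; last first.
    by rewrite mule0 lee_fin !mulr_ge0 ?invr_ge0 ?exprn_ge0.
  apply: le_trans (test_term_le gapB q m f) _; rewrite lee_fin mulrAC ler_wpM2r ?exprn_ge0//.
  have -> : 16 ^- m = 8 ^- m * 2 ^- m :> R by rewrite -invfM -exprMn -natrM.
  rewrite ler_wpM2r ?invr_ge0 ?exprn_ge0// lef_pV2 ?posrE ?exprn_gt0//.
  by rewrite ler_eXn2l// ltr1n.
rewrite lee_fin !exprMn.
have h : 8 ^- n <= 2 ^- n ^+ 2 :> R.
  by rewrite -!exprVn -exprM mulnC exprM lerXn2r ?nnegrE ?sqr_ge0 ?invr_ge0// expr2; lra.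
have n2 := sqr_ge0 (N (q + gain gapB) f).
apply: (@le_trans _ _ (2 * (2 ^- n ^+ 2 * N (q + gain gapB) f ^+ 2))).
  by rewrite ler_pM2l// ler_wpM2r.
have := mulr_ge0 (sqr_ge0 (2 ^- n : R)) n2; rewrite -natrX => h'.
rewrite -mulrA [X in _ <= _ * X]mulrC; lra.
Qed.

End Totality.

(** * The convolution map *)

Section Main.
Variables (R : realType) (V : lmodType R) (dot : V -> V -> R).
Variables (A : unbounded V) (B : V -> V) (kappa beta : R).
Hypothesis gapB : gapped_inverse dot A B kappa.
Hypotheses (beta_ge0 : 0 <= beta) (beta_lt1 : beta < 1).
Local Notation X := (test dot A beta).
Local Notation N := (@test_norm R V dot A beta).
Local Notation dp := (dotp dot B).
Local Notation dual := (dual dot A beta).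
Local Notation lop := (lop dot A beta).
Local Notation conv := (conv gapB beta_ge0).
Implicit Types (phi psi chi : dual) (f : X).

Let dp_ip p : inner_product (dp p) := dotp_ip (gi_ip gapB) (gi_inv gapB) (gi_lin gapB) p.

Lemma S_transform_inj psi chi :
  (forall xi, testEC A xi -> S_transform psi xi = S_transform chi xi) -> psi = chi.
Proof.
move=> h; apply/val_inj/funext => f; apply/eqP; rewrite -subr_eq0; apply/eqP.
apply: (@functional_total _ _ _ _ _ _ _ gapB beta_ge0 (fun x => exp_vector dot A beta (x, 0)) _ (psi - chi)).
  by move=> x s Ex; exact: (exp_vectorE gapB beta_lt1 _ (testEC_real gapB Ex)).
move=> x Ex; apply/eqP; rewrite subr_eq0; apply/eqP.
exact: h (x, 0) (testEC_real gapB Ex).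
Qed.

Lemma S_transform_conv phi psi xi : testEC A xi ->
  S_transform (dual_comp psi (conv phi)) xi = S_transform phi xi * S_transform psi xi.
Proof.
move=> Exi; rewrite /S_transform -[LHS]/(psi (conv phi (exp_vector dot A beta xi))).
by rewrite (conv_exp gapB beta_ge0 beta_lt1)// dualZ.
Qed.

(** Since [conv phi] multiplies [exp_vector xi] by [S_transform phi xi], composing with
    it multiplies [S]-transforms. *)
Lemma wickE phi psi : wick phi psi = dual_comp psi (conv phi).
Proof.
apply: S_transform_inj => xi Exi; rewrite S_transform_conv//.
rewrite /wick /S_inverse; case: xgetP => [Psi _ ->//|/(_ (dual_comp psi (conv phi))) []].
by move=> eta Eeta; exact: S_transform_conv.
Qed.

Lemma S_transform_wick phi psi xi : testEC A xi ->
  S_transform (wick phi psi) xi = S_transform phi xi * S_transform psi xi.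
Proof. by move=> Exi; rewrite wickE S_transform_conv. Qed.

(** A single vector [x] is a Bessel family with bound its squared norm. *)
Lemma eval_bound s f : normc (f s) ^+ 2 <= (\prod_(x <- s) dp 0 x x) * N 0 f ^+ 2.
Proof.
have := @ssq_le_hs _ _ (dp 0) [seq (dp 0 x x, [:: x]) | x <- s] f (dp_ip 0) _ (test_multilinear f).
rewrite -map_comp size_map big_map (eq_map (g := fun x => [:: x]))// /ssq words_singletons big_seq1 /=.
move=> h; rewrite -lee_fin; apply: le_trans (h _) _.
  by move=> _ /mapP[x _ ->]; exact: (bessel1 (dp_ip 0)).
rewrite EFinM; apply: lee_wpmul2l.
  by rewrite lee_fin prodr_ge0// => x _; exact: (ip_ge0 (dp_ip 0)).
rewrite -chaos_normK; apply: le_trans (chaos_term_le beta gapB 0 f (size s)).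
rewrite -[leLHS]mul1e; apply: lee_wpmul2r; first exact: hs_ge0.
by rewrite lee_fin weight_ge1.
Qed.

Lemma eval_is_dual s : (fun f : X => f s) \in @is_dual R V dot A beta.
Proof.
pose K := \prod_(x <- s) dp 0 x x.
have K0 : 0 <= K by rewrite prodr_ge0// => x _; exact: (ip_ge0 (dp_ip 0)).
apply: (@continuous_functional _ _ _ _ _ _ 0%N (Num.sqrt K)) => // f.
rewrite -(@ler_pXn2r _ 2)// ?nnegrE ?normc_ge0 ?mulr_ge0 ?sqrtr_ge0 ?test_norm_ge0//.
by rewrite exprMn sqr_sqrtr//; exact: eval_bound.
Qed.

Definition eval s : dual := Dual (eval_is_dual s).

Lemma dual_separates f g : (forall psi, psi f = psi g) -> f = g.
Proof. by move=> h; apply/val_inj/funext => s; exact: (h (eval s)). Qed.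

Lemma convolutionE phi : convolution phi = conv phi.
Proof.
rewrite /convolution; case: xgetP => [T _ hT|/(_ (conv phi)) []]; last first.
  by move=> psi f; rewrite wickE.
apply/val_inj/funext => f; apply: dual_separates => psi.
by rewrite -[LHS]/(psi (T f)) hT wickE.
Qed.

Lemma wickA phi psi chi : wick (wick phi psi) chi = wick psi (wick phi chi).
Proof.
by apply: S_transform_inj => xi Exi; rewrite !S_transform_wick// mulrCA mulrA.
Qed.

Lemma conv_wick phi psi : conv (wick phi psi) = lop_comp (conv phi) (conv psi).
Proof.
apply/val_inj/funext => f; apply: dual_separates => chi.
transitivity (wick (wick phi psi) chi f); first by rewrite (wickE (wick phi psi)).
by rewrite wickA (wickE psi) /= (wickE phi chi).
Qed.

(** [annihT [::]] is the identity. In other words, the vacuum expectation is the unit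
    of the Wick product; composition with it inverts the convolution map. *)
Lemma vacuum_conv phi : dual_comp (eval [::]) (conv phi) = phi.
Proof.
apply/val_inj/funext => f; rewrite -[LHS]/(phi (annihT gapB beta_ge0 [::] f)); congr (phi _).
by apply/val_inj/funext => t; rewrite /= /annih /= bin0 mul1r.
Qed.

Lemma vacuum_continuous : continuous (fun T : lop => dual_comp (eval [::]) T).
Proof.
apply: continuous_to_dual => T M e bM e0.
have := near_lop T 0 bM e0; apply: filterS => U h f Mf.
apply: le_lt_trans (h f Mf); have := eval_bound [::] (T f - U f).
by rewrite big_nil mul1r ler_pXn2r ?nnegrE ?normc_ge0 ?test_norm_ge0.
Qed.

End Main.

Theorem theorem4p7 (R : realType) (A : unbounded (L2 R)) (beta : R)
  (hA : white_noise_op (@l2dot R) A) (beta_ge0 : 0 <= beta) (beta_lt1 : beta < 1) :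
  let C := @convolution R (L2 R) (@l2dot R) A beta in
  [/\ (forall phi psi, C (phi + psi) = C phi + C psi),
      (forall (a : R[i]) phi, C (a *: phi) = a *: C phi) &
      (forall phi psi, C (wick phi psi) = lop_comp (C phi) (C psi))] /\
  [/\ injective C, continuous C &
      exists2 D : lop (@l2dot R) A beta -> dual (@l2dot R) A beta,
        cancel C D & {within range C, continuous D}].
Proof.
have [B [kappa gapB]] := white_noise_gapped hA.
have -> : @convolution R (L2 R) (@l2dot R) A beta = conv gapB beta_ge0.
  by apply/funext => phi; exact: convolutionE.
have canD := vacuum_conv gapB beta_ge0.
split; split.
- by move=> phi psi; rewrite -[phi]scale1r conv_linear !scale1r.
- by move=> a phi; apply/val_inj/funext => f; exact/val_inj/funext.
- by move=> phi psi; exact: conv_wick.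
- exact: can_inj canD.
- exact: conv_continuous.
exists (fun T => dual_comp (eval gapB beta_ge0 [::]) T); first exact: canD.
by apply: continuous_subspaceT; exact: vacuum_continuous.
Qed.
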